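(* Let $\lambda=(f,n-2f)$ and $\mu=(f-1,n-2f+1)$ be partitions (of $n$ and $n-1$ respectively), where $n-2f\ge0$ and $f\ge1$. Then $$\det(\lambda)=\prod_{\nu\to\lambda}\det(\nu)\cdot\left(\frac{p_{n-2f+2}}{p_{n-2f+1}}\right)^{\dim(\mu)},$$ where the product is over all partitions $\nu$ of $n-1$ with $\nu\to\lambda$.
   Context: Let $x$ be an indeterminate, $R=\mathbb{Z}[x]$ and $F$ the field of fractions of $R$. The Temperley–Lieb algebra $\mathcal{A}_n(x)$ is the unital associative $R$-algebra generated by $e_1,\dots,e_{n-1}$ subject to $e_i^2=xe_i$; $e_ie_{i\pm1}e_i=e_i$ (whenever both indices lie in $\{1,\dots,n-1\}$); $e_ie_j=e_je_i$ for $|i-j|\ge2$. By convention $\mathcal{A}_1(x)=R$, and $\mathcal{A}_i(x)$ is regarded as the subalgebra of $\mathcal{A}_{i+1}(x)$ generated by $e_1,\dots,e_{i-1}$. A partition of $n$ means a pair of integers $(i,n-2i)$ with $0\le 2i\le n$. For partitions $\lambda=(i,n-2i)$, $\mu=(j,n-2j)$ of $n$, $\lambda\unrhd\mu$ means $i\ge j$, and $\lambda\rhd\mu$ means $\lambda\unrhd\mu$ and $\lambda\ne\mu$. If $\mu$ is a partition of $n-1$ and $\lambda=(i,n-2i)$ a partition of $n$, write $\mu\to\lambda$ if $\mu=(i,n-2i-1)$ or $\mu=(i-1,n-2i+1)$. $\mathfrak{T}_n(\lambda)$ is the set of sequences $(\lambda^{(0)},\dots,\lambda^{(n)})$, with $\lambda^{(k)}$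 a partition of $k$, such that $\lambda^{(0)}=(0,0)$, $\lambda^{(k-1)}\to\lambda^{(k)}$ for $k=1,\dots,n$, and $\lambda^{(n)}=\lambda$. For $\mathfrak{s}=(\lambda^{(0)},\dots,\lambda^{(n)})$ write $\mathrm{Shape}(\mathfrak{s})=\lambda^{(n)}$ and $\mathfrak{s}|_k=(\lambda^{(0)},\dots,\lambda^{(k)})$. For $\lambda=(f,n-2f)$ let $m_\lambda=e_1e_3\cdots e_{2f-1}$ ($=1$ if $f=0$). $\mathcal{A}_n^\lambda$ is the two-sided ideal of $\mathcal{A}_n(x)$ generated by $m_\lambda$ and $\check{\mathcal{A}}_n^\lambda=\sum_{\mu\rhd\lambda}\mathcal{A}_n^\mu$. Put $w_{i,j}=e_ie_{i+1}\cdots e_{j-1}$ if $i<j$, $w_{i,j}=e_{i-1}e_{i-2}\cdots e_j$ if $j<i$, $w_{i,i}=1$. Define $v_{\mathfrak{t}}=1$ if $\mathfrak{t}=((0,0))$; if $\mathfrak{t}\in\mathfrak{T}_n(\lambda)$, $\lambda=(f,n-2f)$, $\mathfrak{s}=\mathfrak{t}|_{n-1}$, then $v_{\mathfrak{t}}=v_{\mathfrak{s}}$ if $\mathrm{Shape}(\mathfrak{s})=(f,n-2f-1)$ and $v_{\mathfrak{t}}=w_{2f,n}v_{\mathfrak{s}}$ if $\mathrm{Shape}(\mathfrak{s})=(f-1,n-2f+1)$. $C^\lambda$ is the right submodule of $\mathcal{A}_n(x)/\check{\mathcal{A}}_n^\lambda$ generated by $m_\lambda+\check{\mathcal{A}}_n^\lambda$,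 with $R$-basis $m_{\mathfrak{t}}=m_\lambda v_{\mathfrak{t}}+\check{\mathcal{A}}_n^\lambda$, $\mathfrak{t}\in\mathfrak{T}_n(\lambda)$; from here on $C^\lambda$ is extended to a module over $\mathcal{A}_n(x)\otimes_RF$. Let $*$ be the anti-involution of the algebra fixing each $e_i$. The bilinear form on $C^\lambda$ is the standard cellular form, determined by $m_\lambda v_{\mathfrak{s}}v_{\mathfrak{t}}^*m_\lambda\equiv\langle m_{\mathfrak{s}},m_{\mathfrak{t}}\rangle m_\lambda \bmod\check{\mathcal{A}}_n^\lambda$. Define $T_0=T_1=0$, $T_2=e_1$ and $T_{i+1}=-e_iT_i-T_ie_i+e_ie_{i-1}T_ie_i-z_{i-1}-e_iz_{i-2}$ for $i\ge2$, where $z_0=z_1=0$ and $z_i=\sum_{k=0}^ix^kT_{i-k}$ for $i\ge2$. Define $p_0=0$, $p_1=1$, $p_{i+1}=xp_i-p_{i-1}$ for $i\ge 1$. For $\mathfrak{t}\in\mathfrak{T}_n(\lambda)$ define $r_{\mathfrak{t}}(0)=r_{\mathfrak{t}}(1)=0$ and, for $k\ge2$ with $\mathrm{Shape}(\mathfrak{t}|_k)=(i,k-2i)$: $r_{\mathfrak{t}}(k)=(p_i-xp_{i-1})p_{k-i+1}$ if $\mathrm{Shape}(\mathfrak{t}|_{k-1})=(i-1,k-2i+1)$, and $r_{\mathfrak{t}}(k)=(p_{k-i+1}-xp_{k-i})p_i$ if $\mathrm{Shape}(\mathfrak{t}|_{k-1})=(i,k-2i-1)$. Let $\mathfrak{R}(k)=\{r_{\mathfrak{t}}(k):\mathfrak{t}\in\mathfrak{T}_k(\mu),\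 \mu\text{ a partition of }k\}$, and for $\mathfrak{t}\in\mathfrak{T}_n(\lambda)$ let $$F_{\mathfrak{t}}=\prod_{k=2}^n\ \prod_{r\in\mathfrak{R}(k),\,r\ne r_{\mathfrak{t}}(k)}\frac{T_k-r}{r_{\mathfrak{t}}(k)-r},\qquad f_{\mathfrak{t}}=m_{\mathfrak{t}}F_{\mathfrak{t}}.$$ For a partition $\lambda$ of $n$: $\dim(\lambda)=\#\mathfrak{T}_n(\lambda)$, and $\det(\lambda)=\prod_{\mathfrak{t}\in\mathfrak{T}_n(\lambda)}\langle f_{\mathfrak{t}},f_{\mathfrak{t}}\rangle$, the determinant of the Gram matrix associated with $C^\lambda$ (with respect to the basis $m_{\mathfrak{t}}$). *)

(* Defs.v *)
From HB Require Import structures.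
From mathcomp Require Import all_boot all_order all_algebra.
From mathcomp Require Import boolp classical_sets.

Set Implicit Arguments.
Unset Strict Implicit.
Unset Printing Implicit Defensive.

Import GRing.Theory.

Local Open Scope ring_scope.
Local Open Scope quotient_scope.

Definition tl_index (n : nat) := {i : nat | (0 < i < n)%N}.

(* Formal expressions in the generators e_1, ..., e_(n-1) and the scalars. *)
Inductive tl_term (K : Type) (n : nat) : Type :=
| TLscal of K
| TLgen of tl_index n
| TLadd of tl_term K n & tl_term K n
| TLmul of tl_term K n & tl_term K n.

Arguments TLscal {K n}.
Arguments TLgen {K n}.

HB.instance Definition _ K n := gen_eqMixin (tl_term K n).
HB.instance Definition _ K n := gen_choiceMixin (tl_term K n).

(* The least congruence containing the axioms of associative unital
   K-algebras and the Temperley-Lieb relations with loop parameter d. *)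
Inductive tl_eq (K : comNzRingType) (d : K) (n : nat) :
  tl_term K n -> tl_term K n -> Prop :=
| tl_refl a : tl_eq d a a
| tl_sym a b : tl_eq d a b -> tl_eq d b a
| tl_trans b a c : tl_eq d a b -> tl_eq d b c -> tl_eq d a c
| tl_congD a a' b b' :
    tl_eq d a a' -> tl_eq d b b' -> tl_eq d (TLadd a b) (TLadd a' b')
| tl_congM a a' b b' :
    tl_eq d a a' -> tl_eq d b b' -> tl_eq d (TLmul a b) (TLmul a' b')
| tl_addA a b c : tl_eq d (TLadd a (TLadd b c)) (TLadd (TLadd a b) c)
| tl_addC a b : tl_eq d (TLadd a b) (TLadd b a)
| tl_add0 a : tl_eq d (TLadd (TLscal 0) a) a
| tl_addN a : tl_eq d (TLadd (TLmul (TLscal (-1)) a) a) (TLscal 0)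
| tl_mulA a b c : tl_eq d (TLmul a (TLmul b c)) (TLmul (TLmul a b) c)
| tl_mul1 a : tl_eq d (TLmul (TLscal 1) a) a
| tl_mulDl a b c :
    tl_eq d (TLmul (TLadd a b) c) (TLadd (TLmul a c) (TLmul b c))
| tl_mulDr a b c :
    tl_eq d (TLmul a (TLadd b c)) (TLadd (TLmul a b) (TLmul a c))
| tl_scalD k l : tl_eq d (TLscal (k + l)) (TLadd (TLscal k) (TLscal l))
| tl_scalM k l : tl_eq d (TLscal (k * l)) (TLmul (TLscal k) (TLscal l))
| tl_scalC k a : tl_eq d (TLmul (TLscal k) a) (TLmul a (TLscal k))
| tl_sq i : tl_eq d (TLmul (TLgen i) (TLgen i)) (TLmul (TLscal d) (TLgen i))
| tl_braid (i j : tl_index n) : (val j == (val i).+1) || (val i == (val j).+1) ->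
    tl_eq d (TLmul (TLmul (TLgen i) (TLgen j)) (TLgen i)) (TLgen i)
| tl_comm (i j : tl_index n) : ((val i).+2 <= val j)%N || ((val j).+2 <= val i)%N ->
    tl_eq d (TLmul (TLgen i) (TLgen j)) (TLmul (TLgen j) (TLgen i)).

Definition tl_eqb (K : comNzRingType) (d : K) n : rel (tl_term K n) :=
  fun a b => `[< tl_eq d a b >].

Lemma tl_eqb_equiv (K : comNzRingType) (d : K) n : equiv_class_of (@tl_eqb K d n).
Proof.
split=> [a|a b|b a c]; first exact/asboolP/tl_refl.
- by apply/asboolP/asboolP; apply: tl_sym.
- by move=> /asboolP ab /asboolP bc; apply/asboolP/(tl_trans ab bc).
Qed.

Canonical tl_equiv (K : comNzRingType) (d : K) n :=
  EquivRelPack (@tl_eqb_equiv K d n).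

Section Eval.
Variables (K L : comNzRingType) (phi : {rmorphism K -> L}) (B : algType L).
Variables (d : K) (n : nat) (b : tl_index n -> B).

Definition tl_relations : Prop :=
  [/\ forall i, b i * b i = phi d *: b i,
      forall i j : tl_index n, (val j == (val i).+1) || (val i == (val j).+1) ->
        b i * b j * b i = b i
    & forall i j : tl_index n, ((val i).+2 <= val j)%N || ((val j).+2 <= val i)%N ->
        b i * b j = b j * b i].

Fixpoint tl_eval (a : tl_term K n) : B :=
  match a with
  | TLscal k => (phi k)%:A
  | TLgen i => b i
  | TLadd a1 a2 => tl_eval a1 + tl_eval a2
  | TLmul a1 a2 => tl_eval a1 * tl_eval a2
  end.

Lemma tl_eval_eq a1 a2 :
  tl_relations -> tl_eq d a1 a2 -> tl_eval a1 = tl_eval a2.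
Proof.
case=> bsq bbr bcm; elim=> //=.
- by move=> *; congruence.
- by move=> ? ? ? ? _ -> _ ->.
- by move=> ? ? ? ? _ -> _ ->.
- by move=> *; rewrite addrA.
- by move=> *; rewrite addrC.
- by move=> *; rewrite rmorph0 scale0r add0r.
- by move=> *; rewrite rmorphN1 mulr_algl scaleN1r addNr rmorph0 scale0r.
- by move=> *; rewrite mulrA.
- by move=> *; rewrite rmorph1 scale1r mul1r.
- by move=> *; rewrite mulrDl.
- by move=> *; rewrite mulrDr.
- by move=> *; rewrite rmorphD scalerDl.
- by move=> *; rewrite rmorphM mulr_algl scalerA.
- by move=> *; rewrite mulr_algl mulr_algr.
- by move=> *; rewrite mulr_algl bsq.
Qed.

End Eval.

Definition TL (K : comNzRingType) (d : K) (n : nat) : Type :=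
  {eq_quot (@tl_eqb K d n)}.

Section TLAlgebra.
Variables (K : comNzRingType) (d : K) (n : nat).
Local Notation A := (TL d n).

HB.instance Definition _ := Choice.on A.
HB.instance Definition _ := EqQuotient.on A.

Implicit Types a b c : tl_term K n.

Lemma tl_eqP a b : (\pi_A a = \pi_A b) <-> tl_eq d a b.
Proof.
split; first by move/eqmodP/asboolP.
by move=> ab; apply/eqmodP/asboolP.
Qed.

Lemma tl_reprP a : tl_eq d (repr (\pi_A a)) a.
Proof. by apply/tl_eqP; rewrite reprK. Qed.

Definition tl_add (u v : A) : A := \pi_A (TLadd (repr u) (repr v)).
Definition tl_mul (u v : A) : A := \pi_A (TLmul (repr u) (repr v)).
Definition tl_opp (u : A) : A := \pi_A (TLmul (TLscal (-1)) (repr u)).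
Definition tl_scale (k : K) (u : A) : A := \pi_A (TLmul (TLscal k) (repr u)).

Let piD a b : tl_add (\pi_A a) (\pi_A b) = \pi_A (TLadd a b).
Proof. by apply/tl_eqP/tl_congD; apply: tl_reprP. Qed.
Let piM a b : tl_mul (\pi_A a) (\pi_A b) = \pi_A (TLmul a b).
Proof. by apply/tl_eqP/tl_congM; apply: tl_reprP. Qed.
Let piN a : tl_opp (\pi_A a) = \pi_A (TLmul (TLscal (-1)) a).
Proof. by apply/tl_eqP/tl_congM; [apply: tl_refl|apply: tl_reprP]. Qed.
Let piZ k a : tl_scale k (\pi_A a) = \pi_A (TLmul (TLscal k) a).
Proof. by apply/tl_eqP/tl_congM; [apply: tl_refl|apply: tl_reprP]. Qed.

Let qW (P : A -> Prop) : (forall a, P (\pi_A a)) -> forall u, P u.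
Proof. by move=> Pa u; rewrite -[u]reprK. Qed.

Let addA : associative tl_add.
Proof.
elim/qW=> a; elim/qW=> b; elim/qW=> c; rewrite !piD.
exact/tl_eqP/tl_addA.
Qed.
Let addC : commutative tl_add.
Proof. by elim/qW=> a; elim/qW=> b; rewrite !piD; apply/tl_eqP/tl_addC. Qed.
Let add0 : left_id (\pi_A (TLscal 0)) tl_add.
Proof. by elim/qW=> a; rewrite piD; apply/tl_eqP/tl_add0. Qed.
Let addN : left_inverse (\pi_A (TLscal 0)) tl_opp tl_add.
Proof. by elim/qW=> a; rewrite piN piD; apply/tl_eqP/tl_addN. Qed.

HB.instance Definition _ := GRing.isZmodule.Build A addA addC add0 addN.

Let mulA : associative tl_mul.
Proof.
elim/qW=> a; elim/qW=> b; elim/qW=> c; rewrite !piM.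
exact/tl_eqP/tl_mulA.
Qed.
Let mul1 : left_id (\pi_A (TLscal 1)) tl_mul.
Proof. by elim/qW=> a; rewrite piM; apply/tl_eqP/tl_mul1. Qed.
Let mulr1 : right_id (\pi_A (TLscal 1)) tl_mul.
Proof.
elim/qW=> a; rewrite piM; apply/tl_eqP.
exact: tl_trans (tl_sym (tl_scalC d 1 a)) (tl_mul1 d a).
Qed.
Let mulDl : left_distributive tl_mul +%R.
Proof.
elim/qW=> a; elim/qW=> b; elim/qW=> c.
by rewrite [_ + _]piD [RHS]/GRing.add /= !piM piD; apply/tl_eqP/tl_mulDl.
Qed.
Let mulDr : right_distributive tl_mul +%R.
Proof.
elim/qW=> a; elim/qW=> b; elim/qW=> c.
by rewrite [\pi_A b + _]piD [RHS]/GRing.add /= !piM piD; apply/tl_eqP/tl_mulDr.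
Qed.
Let one_neq0 : \pi_A (TLscal 1) != 0.
Proof.
apply/eqP => /tl_eqP eq10.
have rel0 : @tl_relations K K idfun K^o d n (fun=> 0).
  by split=> *; rewrite ?mulr0 ?scaler0.
have /eqP := tl_eval_eq rel0 eq10.
by rewrite /= scale1r scale0r oner_eq0.
Qed.

HB.instance Definition _ :=
  GRing.Zmodule_isNzRing.Build A mulA mul1 mulr1 mulDl mulDr one_neq0.

Let scaleA k l (u : A) : tl_scale k (tl_scale l u) = tl_scale (k * l) u.
Proof.
elim/qW: u => a; rewrite !piZ; apply/tl_eqP/(tl_trans (tl_mulA _ _ _ _)).
exact: tl_congM (tl_sym (tl_scalM _ _ _ _)) (tl_refl _ _).
Qed.
Let scale1 : left_id 1 tl_scale.
Proof. by elim/qW=> a; rewrite piZ; apply/tl_eqP/tl_mul1. Qed.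
Let scaleDr : right_distributive tl_scale +%R.
Proof.
move=> k; elim/qW=> a; elim/qW=> b.
by rewrite [_ + _]piD [RHS]/GRing.add /= !piZ piD; apply/tl_eqP/tl_mulDr.
Qed.
Let scaleDl (u : A) : {morph tl_scale^~ u : k l / k + l}.
Proof.
elim/qW: u => a k l; rewrite [RHS]/GRing.add /= !piZ piD; apply/tl_eqP.
apply: tl_trans (tl_mulDl _ _ _ _).
exact: tl_congM (tl_scalD _ _ _ _) (tl_refl _ _).
Qed.

HB.instance Definition _ :=
  GRing.Zmodule_isLmodule.Build K A scaleA scale1 scaleDr scaleDl.

Let scaleAl (k : K) (u v : A) : k *: (u * v) = (k *: u) * v.
Proof.
elim/qW: u => a; elim/qW: v => b.
rewrite /GRing.scale /= /GRing.mul /= !(piM, piZ).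
exact/tl_eqP/tl_mulA.
Qed.

HB.instance Definition _ := GRing.Lmodule_isLalgebra.Build K A scaleAl.

Let scaleAr (k : K) (u v : A) : k *: (u * v) = u * (k *: v).
Proof.
elim/qW: u => a; elim/qW: v => b.
rewrite /GRing.scale /= /GRing.mul /= !(piM, piZ); apply/tl_eqP.
apply/(tl_trans (tl_mulA _ _ _ _))/tl_sym/(tl_trans (tl_mulA _ _ _ _)).
exact: tl_congM (tl_sym (tl_scalC _ _ _)) (tl_refl _ _).
Qed.

HB.instance Definition _ := GRing.Lalgebra_isAlgebra.Build K A scaleAr.

Lemma tl_piD a b : \pi_A (TLadd a b) = \pi_A a + \pi_A b.
Proof. by rewrite -piD. Qed.
Lemma tl_piM a b : \pi_A (TLmul a b) = \pi_A a * \pi_A b.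
Proof. by rewrite -piM. Qed.
Lemma tl_piS k : \pi_A (TLscal k) = k%:A.
Proof.
rewrite -[RHS]/(tl_scale k _) piZ; apply/tl_eqP/tl_sym.
exact: tl_trans (tl_scalC _ _ _) (tl_mul1 _ _).
Qed.

Definition tl_gen (i : tl_index n) : A := \pi_A (TLgen i).

(* The generator e_i; the value 0 outside 1 <= i < n is never used. *)
Definition tl_e (i : nat) : A :=
  if insub i is Some j then tl_gen j else 0.

Lemma tl_eE (j : tl_index n) : tl_e (val j) = tl_gen j.
Proof. by rewrite /tl_e valK. Qed.

Lemma tl_gen_relations : @tl_relations K K idfun A d n tl_gen.
Proof.
rewrite /tl_gen; split=> [i|i j ij|i j ij].
- rewrite -tl_piM; have/tl_eqP -> := tl_sq d i.
  by rewrite tl_piM tl_piS mulr_algl.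
- by rewrite -(tl_piM (TLgen i)) -tl_piM; apply/tl_eqP; apply: tl_braid.
- by rewrite -2!tl_piM; apply/tl_eqP; apply: tl_comm.
Qed.

Fixpoint tl_rev (a : tl_term K n) : tl_term K n :=
  match a with
  | TLadd a1 a2 => TLadd (tl_rev a1) (tl_rev a2)
  | TLmul a1 a2 => TLmul (tl_rev a2) (tl_rev a1)
  | _ => a
  end.

Lemma tl_rev_eq a b : tl_eq d a b -> tl_eq d (tl_rev a) (tl_rev b).
Proof.
elim=> /=; do ?by move=> *; constructor.
- by move=> b1 a1 c1 _ ab _ bc; apply: tl_trans ab bc.
- move=> a1; apply: tl_trans (tl_addN d (tl_rev a1)).
  exact: tl_congD (tl_sym (tl_scalC _ _ _)) (tl_refl _ _).
- by move=> *; apply/tl_sym/tl_mulA.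
- move=> a1; apply: tl_trans (tl_mul1 d (tl_rev a1)).
  exact: tl_sym (tl_scalC _ _ _).
- by move=> k l; rewrite mulrC; apply: tl_scalM.
- by move=> *; apply/tl_sym/tl_scalC.
- move=> i; apply: tl_trans (tl_scalC _ _ _); exact: tl_sq.
- move=> i j ij; apply: tl_trans (tl_braid d ij); exact: tl_mulA.
- by move=> i j ij; apply: tl_comm; rewrite orbC.
Qed.

Definition tl_star (u : A) : A := \pi_A (tl_rev (repr u)).

Lemma tl_star_pi a : tl_star (\pi_A a) = \pi_A (tl_rev a).
Proof. exact/tl_eqP/tl_rev_eq/tl_reprP. Qed.

Lemma tl_starM u v : tl_star (u * v) = tl_star v * tl_star u.
Proof.
elim/qW: u => a; elim/qW: v => b.
by rewrite -tl_piM !tl_star_pi /= tl_piM.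
Qed.

Lemma tl_star_linear : linear tl_star.
Proof.
move=> k; elim/qW=> a; elim/qW=> b.
rewrite -[k *: \pi_A a]mulr_algl -[k *: tl_star _]mulr_algr -!tl_piS.
by rewrite -tl_piM -tl_piD !tl_star_pi /= tl_piD tl_piM.
Qed.

Lemma tl_star_gen i : tl_star (tl_gen i) = tl_gen i.
Proof. exact: tl_star_pi. Qed.

Lemma tl_starK : involutive tl_star.
Proof.
elim/qW=> a; rewrite !tl_star_pi; congr (\pi_A _).
by elim: a => //= a1 -> a2 ->.
Qed.

End TLAlgebra.

Section Universal.
Variables (K L : comNzRingType) (phi : {rmorphism K -> L}) (B : algType L).
Variables (d : K) (n : nat) (b : tl_index n -> B).
Hypothesis b_rel : tl_relations phi d b.

Definition tl_lift (u : TL d n) : B := tl_eval phi b (repr u).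

Lemma tl_lift_pi a : tl_lift (\pi a) = tl_eval phi b a.
Proof. exact/(tl_eval_eq b_rel)/tl_reprP. Qed.

Lemma tl_liftP :
  [/\ zmod_morphism tl_lift, monoid_morphism tl_lift,
      forall k u, tl_lift (k *: u) = phi k *: tl_lift u
    & forall i, tl_lift (tl_gen d i) = b i].
Proof.
have liftD u v : tl_lift (u + v) = tl_lift u + tl_lift v.
  by rewrite -[u]reprK -[v]reprK -tl_piD !tl_lift_pi.
have liftM u v : tl_lift (u * v) = tl_lift u * tl_lift v.
  by rewrite -[u]reprK -[v]reprK -tl_piM !tl_lift_pi.
have liftS k : tl_lift k%:A = (phi k)%:A by rewrite -tl_piS tl_lift_pi.
have liftZ k u : tl_lift (k *: u) = phi k *: tl_lift u.
  by rewrite -mulr_algl liftM liftS mulr_algl.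
split=> [u v|||i]; first by rewrite liftD -scaleN1r liftZ rmorphN1 scaleN1r.
- by split=> //; rewrite -[1]scale1r liftS rmorph1 scale1r.
- exact: liftZ.
- exact: tl_lift_pi.
Qed.

Lemma tl_lift_unique (g : TL d n -> B) :
    zmod_morphism g -> monoid_morphism g ->
    (forall k u, g (k *: u) = phi k *: g u) ->
    (forall i, g (tl_gen d i) = b i) ->
  g =1 tl_lift.
Proof.
move=> gB [g1 gM] gZ g_gen u; rewrite -[u]reprK tl_lift_pi.
have g0 : g 0 = 0 by rewrite -[X in g X](subrr 0) gB subrr.
have gD v w : g (v + w) = g v + g w.
  by rewrite -[w in LHS]opprK gB -[- w]sub0r gB g0 sub0r opprK.
elim: (repr u) => [k|i|a1 IH1 a2 IH2|a1 IH1 a2 IH2] /=.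
- by rewrite tl_piS gZ g1.
- exact: g_gen.
- by rewrite tl_piD gD IH1 IH2.
- by rewrite tl_piM gM IH1 IH2.
Qed.

End Universal.


Notation part := (nat * nat)%type (only parsing).

Definition is_part (n : nat) (l : part) : bool := (2 * l.1 + l.2 == n)%N.

Definition parts (n : nat) : seq part :=
  [seq (i, n - 2 * i)%N | i <- iota 0 (n./2).+1].

Lemma mem_parts n l : (l \in parts n) = is_part n l.
Proof.
case: l => i m; rewrite /is_part /=; apply/mapP/eqP => [[j]|<-].
  by rewrite mem_iota add0n ltnS /= geq_half_double -mul2n => jn [-> ->]; rewrite subnKC.
exists i; last by rewrite addKn.
by rewrite mem_iota add0n ltnS /= geq_half_double -mul2n leq_addr.
Qed.

Lemma parts_uniq n : uniq (parts n).
Proof. by rewrite map_inj_uniq ?iota_uniq // => i j []. Qed.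

Definition dominates (l m : part) : bool := (m.1 <= l.1)%N.
Definition sdominates (l m : part) : bool := dominates l m && (l != m).

(* The relation m -> l: for l = (i, k), either m = (i, k - 1) or
   m = (i - 1, k + 1). *)
Definition arrow (m l : part) : bool :=
  ((m.1 == l.1) && (m.2.+1 == l.2)) || ((m.1.+1 == l.1) && (m.2 == l.2.+1)).

Notation tableau := (seq (nat * nat)) (only parsing).

Definition shape (t : tableau) (k : nat) : part := nth (0, 0)%N t k.

Definition is_tableau (n : nat) (l : part) (t : tableau) : bool :=
  [&& size t == n.+1, shape t 0 == (0, 0)%N, shape t n == l,
      all (fun k => is_part k (shape t k)) (iota 0 n.+1)
    & all (fun k => arrow (shape t k) (shape t k.+1)) (iota 0 n)].

Fixpoint tableaux (n : nat) (l : part) : seq tableau :=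
  match n with
  | 0%N => if l == (0, 0)%N then [:: [:: l]] else [::]
  | n'.+1 =>
      if is_part n l then
        [seq rcons t l | m <- [seq m <- parts n' | arrow m l], t <- tableaux n' m]
      else [::]
  end.

Lemma tableauxS n l :
  tableaux n.+1 l =
  if is_part n.+1 l then
    [seq rcons t l | m <- [seq m <- parts n | arrow m l], t <- tableaux n m]
  else [::].
Proof. by []. Qed.

Lemma is_tableauS n l t l' :
  is_tableau n.+1 l (rcons t l') =
  [&& l' == l, is_part n.+1 l, arrow (shape t n) l & is_tableau n (shape t n) t].
Proof.
rewrite /is_tableau size_rcons eqSS eqxx andTb.
have [st|] := eqVneq (size t) n.+1; last by rewrite !andbF.
have iotaS k : iota 0 k.+1 = rcons (iota 0 k) k.
  by rewrite -addn1 iotaD cats1.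
rewrite (iotaS n.+1) (iotaS n) !all_rcons.
have shr k : (k < n.+1)%N -> shape (rcons t l') k = shape t k.
  by move=> kn; rewrite /shape nth_rcons st kn.
have shn : shape (rcons t l') n.+1 = l'.
  by rewrite /shape nth_rcons st ltnn eqxx.
rewrite shr // shn (shr n) //.
rewrite (@eq_in_all _ (fun k => is_part k (shape (rcons t l') k))
                      (fun k => is_part k (shape t k))); last first.
  by move=> k; rewrite mem_iota => /andP[_ kn]; rewrite shr // ltnW.
rewrite (@eq_in_all _ (fun k => arrow (shape (rcons t l') k) _)
                      (fun k => arrow (shape t k) (shape t k.+1))); last first.
  by move=> k; rewrite mem_iota => /andP[_ kn]; rewrite !shr // ltnW.
have [->|] := eqVneq l' l; last by rewrite !(andbF, andFb).
rewrite !andTb.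
by case: (is_part _ l); case: (arrow _ l); rewrite ?andbF // !andTb.
Qed.

Lemma mem_tableaux n l t : (t \in tableaux n l) = is_tableau n l t.
Proof.
elim: n l t => [|n IHn] l t.
  apply/idP/and5P => [/=|[+ + + _ _]].
    by case: ifP => // /eqP->; rewrite inE => /eqP->.
  case: t => [|m [|m' t]] //= _ /eqP; rewrite /shape /= => -> /eqP <-.
  by rewrite eqxx inE.
case/lastP: t => [|t l'].
  rewrite tableauxS /is_tableau; case: ifP => // _.
  by apply/negP => /allpairsPdep[m [t [_ _ /(congr1 size)]]]; rewrite size_rcons.
rewrite is_tableauS tableauxS; case: ifP => [ln|]; last by rewrite andbF.
apply/allpairsPdep/and4P => [[m [t' [+ + /rcons_inj[-> ->]]]]|].
  rewrite mem_filter IHn => /andP[ml _] tm.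
  by have/and5P[_ _ /eqP-> _ _] := tm.
move=> [/eqP-> _ tl tt]; exists (shape t n), t; split=> //; last by rewrite IHn.
rewrite mem_filter tl mem_parts.
have/and5P[_ _ _ /allP/(_ n) + _] := tt; apply.
by rewrite mem_iota add0n ltnSn.
Qed.

Lemma tableaux_uniq n l : uniq (tableaux n l).
Proof.
elim: n l => [|n IHn] l; first by rewrite /=; case: ifP.
rewrite tableauxS.
case: ifP => // _; apply: allpairs_uniq_dep => [||[m t] [m' t']].
- by rewrite filter_uniq ?parts_uniq.
- by move=> m _; apply: IHn.
move=> /allpairsPdep[m1 [t1 [_ + [-> ->]]]] /allpairsPdep[m2 [t2 [_ + [-> ->]]]].
rewrite !mem_tableaux => /and5P[_ _ /eqP e1 _ _] /and5P[_ _ /eqP e2 _ _].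
by move=> /rcons_inj[tt]; rewrite -e1 -e2 tt.
Qed.

Inductive ideal_gen (A : nzRingType) (S : set A) : set A :=
| ideal_gen_in a of S a : ideal_gen S a
| ideal_gen0 : ideal_gen S 0
| ideal_genD a b of ideal_gen S a & ideal_gen S b : ideal_gen S (a + b)
| ideal_genMl a b of ideal_gen S b : ideal_gen S (a * b)
| ideal_genMr a b of ideal_gen S a : ideal_gen S (a * b).

Section Elements.
Variables (K : comNzRingType) (d : K) (n : nat).
Local Notation A := (TL d n).
Local Notation e := (tl_e d n).

Definition m_part (l : part) : A := \prod_(0 <= j < l.1) e (2 * j).+1.

Definition w_elt (i j : nat) : A :=
  if (i < j)%N then \prod_(i <= k < j) e k
  else \prod_(k <- rev (iota j (i - j))) e k.

(* v_upto t k is v_(t|_k), read in A_n; the two cases of the definition are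
   told apart by the first components of consecutive shapes. *)
Fixpoint v_upto (t : tableau) (k : nat) : A :=
  match k with
  | 0%N => 1
  | k'.+1 =>
      if (shape t k').1 == (shape t k).1 then v_upto t k'
      else w_elt (2 * (shape t k).1) k * v_upto t k'
  end.

Definition v_elt (t : tableau) : A := v_upto t n.

Definition ideal_part (l : part) : set A :=
  ideal_gen [set m_part l]%classic.

Definition ideal_above (l : part) : set A := [set a | exists b : part -> A,
  (forall mu, is_part n mu -> sdominates mu l -> ideal_part mu (b mu)) /\
  a = \sum_(mu <- parts n | sdominates mu l) b mu]%classic.

Definition ideal_aboveb (l : part) : {pred A} :=
  fun a => `[< ideal_above l a >].

Lemma ideal_aboveb_closed l :
  [/\ 0 \in ideal_aboveb l,
      {in ideal_aboveb l &, forall a b, a + b \in ideal_aboveb l},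
      forall c, {in ideal_aboveb l, forall a, c * a \in ideal_aboveb l}
    & forall c, {in ideal_aboveb l, forall a, a * c \in ideal_aboveb l}].
Proof.
split.
- apply/asboolP; exists (fun=> 0); split; last by rewrite big1.
  by move=> *; apply: ideal_gen0.
- move=> _ _ /asboolP[b1 [I1 ->]] /asboolP[b2 [I2 ->]]; apply/asboolP.
  exists (fun mu => b1 mu + b2 mu); rewrite big_split; split=> // mu nmu lmu.
  by apply: ideal_genD; [apply: I1|apply: I2].
- move=> c _ /asboolP[b [Ib ->]]; apply/asboolP.
  exists (fun mu => c * b mu); rewrite mulr_sumr; split=> // mu nmu lmu.
  by apply: ideal_genMl; apply: Ib.
- move=> c _ /asboolP[b [Ib ->]]; apply/asboolP.
  exists (fun mu => b mu * c); rewrite mulr_suml; split=> // mu nmu lmu.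
  by apply: ideal_genMr; apply: Ib.
Qed.

Lemma ideal_aboveb_zmod l : zmod_closed (ideal_aboveb l).
Proof.
have [I0 ID IM _] := ideal_aboveb_closed l.
by split=> // a b Ia Ib; rewrite -mulN1r ID ?IM.
Qed.

HB.instance Definition _ l :=
  GRing.isZmodClosed.Build A (ideal_aboveb l) (ideal_aboveb_zmod l).

Definition cell_quot (l : part) : Type := {ideal_quot (ideal_aboveb l)}.

Section CellModule.
Variable l : part.
Local Notation I := (ideal_aboveb l).
Local Notation Q := (cell_quot l).

HB.instance Definition _ := GRing.Zmodule.on Q.
HB.instance Definition _ := EqQuotient.on Q.

Lemma pi_cellP (a b : A) : (\pi_Q a = \pi_Q b) <-> (a - b \in I).
Proof. by rewrite Quotient.idealrBE; split=> [->|/eqP]. Qed.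

Lemma repr_cell (a : A) : repr (\pi_Q a) - a \in I.
Proof. by apply/pi_cellP; rewrite reprK. Qed.

Lemma pi_cellD : {morph \pi_Q : a b / a + b}.
Proof. by move=> a b; rewrite -[RHS]/(\pi a + \pi b : {ideal_quot I}) !piE. Qed.

Definition cq_scale (k : K) (u : Q) : Q := \pi_Q (k *: repr u).
Definition cq_act (u : Q) (a : A) : Q := \pi_Q (repr u * a).

Lemma cq_scaleE k a : cq_scale k (\pi_Q a) = \pi_Q (k *: a).
Proof.
have [_ _ IM _] := ideal_aboveb_closed l.
by apply/pi_cellP; rewrite -scalerBr -mulr_algl IM ?repr_cell.
Qed.

Lemma cq_actE a b : cq_act (\pi_Q a) b = \pi_Q (a * b).
Proof.
have [_ _ _ IM] := ideal_aboveb_closed l.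
by apply/pi_cellP; rewrite -mulrBl IM ?repr_cell.
Qed.

Let qW (P : Q -> Prop) : (forall a, P (\pi_Q a)) -> forall u, P u.
Proof. by move=> Pa u; rewrite -[u]reprK. Qed.

Let scaleA k k' (u : Q) : cq_scale k (cq_scale k' u) = cq_scale (k * k') u.
Proof. by elim/qW: u => a; rewrite !cq_scaleE scalerA. Qed.
Let scale1 : left_id 1 cq_scale.
Proof. by elim/qW=> a; rewrite cq_scaleE scale1r. Qed.
Let scaleDr : right_distributive cq_scale +%R.
Proof.
by move=> k; elim/qW=> a; elim/qW=> b; rewrite -pi_cellD !cq_scaleE -pi_cellD scalerDr.
Qed.
Let scaleDl (u : Q) : {morph cq_scale^~ u : k k' / k + k'}.
Proof. by elim/qW: u => a k k'; rewrite !cq_scaleE -pi_cellD scalerDl. Qed.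

HB.instance Definition _ :=
  GRing.Zmodule_isLmodule.Build K Q scaleA scale1 scaleDr scaleDl.

Definition cell_pred : {pred Q} :=
  fun u => `[< exists a : A, u = cq_act (\pi_Q (m_part l)) a >].

Lemma cell_pred_submod : submod_closed cell_pred.
Proof.
split=> [|k _ _ /asboolP[a ->] /asboolP[b ->]]; apply/asboolP.
  by exists 0; rewrite cq_actE mulr0; rewrite -[LHS]/(0 : {ideal_quot I}) !piE.
exists (k *: a + b); rewrite !cq_actE.
by rewrite -[k *: \pi_Q _]/(cq_scale _ _) cq_scaleE -pi_cellD mulrDr scalerAr.
Qed.

HB.instance Definition _ := GRing.isSubmodClosed.Build K Q cell_pred cell_pred_submod.

Record cell : Type := Cell { cell_val : Q; _ : cell_val \in cell_pred }.

HB.instance Definition _ := [isSub for cell_val].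
HB.instance Definition _ := [Choice of cell by <:].
HB.instance Definition _ := [SubChoice_isSubZmodule of cell by <:].
HB.instance Definition _ := [SubZmodule_isSubLmodule of cell by <:].

Lemma cell_act_subproof (u : cell) (a : A) : cq_act (val u) a \in cell_pred.
Proof.
case: u => _ /= /asboolP[b ->]; apply/asboolP; exists (b * a).
by rewrite !cq_actE mulrA.
Qed.

Definition cell_act (u : cell) (a : A) : cell := Cell (cell_act_subproof u a).

Lemma cell_gen_subproof : \pi_Q (m_part l) \in cell_pred.
Proof. by apply/asboolP; exists 1; rewrite cq_actE mulr1. Qed.

Definition cell_gen : cell := Cell cell_gen_subproof.

Definition m_tab (t : tableau) : cell := cell_act cell_gen (v_elt t).

Lemma val_m_tab t : val (m_tab t) = \pi_Q (m_part l * v_elt t).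
Proof. exact: cq_actE. Qed.

Definition is_cell_form (B : cell -> cell -> K) : Prop :=
  bilinear_for *%R *%R B /\
  {in tableaux n l &, forall s t,
    \pi_Q (m_part l * v_elt s * tl_star (v_elt t) * m_part l) =
    \pi_Q (B (m_tab s) (m_tab t) *: m_part l)}.

(* The m_t span C^l, so at most one form satisfies is_cell_form. *)
Definition cell_form : cell -> cell -> K :=
  xget (fun _ _ => 0) [set B | is_cell_form B]%classic.

End CellModule.

(* T_upto i = [:: T_0; ...; T_i] *)
Definition z_of (T : seq A) (i : nat) : A :=
  if (i < 2)%N then 0 else \sum_(k < i.+1) d ^+ k *: T`_(i - k).

Fixpoint T_upto (i : nat) : seq A :=
  match i with
  | 0%N => [:: 0]
  | i'.+1 =>
    let T := T_upto i' in
    rcons T (match i' with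
             | 0%N => 0
             | 1%N => e 1
             | _ => - (e i' * T`_i') - T`_i' * e i'
                    + e i' * e i'.-1 * T`_i' * e i'
                    - z_of T i'.-1 - e i' * z_of T i'.-2
             end)
  end.

Definition T_elt (i : nat) : A := (T_upto i)`_i.

Definition z_elt (i : nat) : A :=
  if (i < 2)%N then 0 else \sum_(k < i.+1) d ^+ k *: T_elt (i - k).

Lemma T_upto_nth i j : (j <= i)%N -> (T_upto i)`_j = T_elt j.
Proof.
have sT k : size (T_upto k) = k.+1 by elim: k => //= k <-; rewrite size_rcons.
elim: i => [|i IHi]; first by rewrite leqn0 => /eqP->.
rewrite leq_eqVlt ltnS => /predU1P[-> //|ji].
by rewrite /= nth_rcons sT ltnS ji IHi.
Qed.

Lemma T_elt0 : T_elt 0 = 0. Proof. by []. Qed.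
Lemma T_elt1 : T_elt 1 = 0. Proof. by []. Qed.
Lemma T_elt2 : T_elt 2 = e 1. Proof. by []. Qed.

Lemma T_eltS i : (2 <= i)%N ->
  T_elt i.+1 = - (e i * T_elt i) - T_elt i * e i
               + e i * e i.-1 * T_elt i * e i
               - z_elt i.-1 - e i * z_elt i.-2.
Proof.
move=> i2; have sT : size (T_upto i) = i.+1.
  by elim: (i) => //= k <-; rewrite size_rcons.
have zE k : (k <= i)%N -> z_of (T_upto i) k = z_elt k.
  move=> ki; rewrite /z_of /z_elt; case: ifP => // _; apply: eq_bigr => j _.
  by rewrite T_upto_nth // (leq_trans (leq_subr _ _)).
rewrite {1}/T_elt [T_upto i.+1]/= nth_rcons sT ltnn eqxx T_upto_nth // !zE.
- by case: i i2 {sT zE} => [|[|i]].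
- by rewrite -!subn1 -subnDA leq_subr.
- exact: leq_pred.
Qed.

End Elements.

(* Fx = Frac(Z[x]). The algebra TL xF n over Fx is the scalar extension of the
   algebra TL 'X n over {poly int}: by tl_liftP and tl_lift_unique, ring
   morphisms from the latter to an Fx-algebra that are semilinear along tofrac
   are the same thing as Fx-algebra morphisms from the former. *)
Definition Fx : fieldType := {fraction {poly int}}.
Definition xF : Fx := tofrac ('X : {poly int}).

Fixpoint pF (i : nat) : Fx :=
  match i with
  | 0%N => 0
  | 1%N => 1
  | (i''.+1 as i').+1 => xF * pF i' - pF i''
  end.

Definition r_tab (t : tableau) (k : nat) : Fx :=
  if (k < 2)%N then 0
  else
    let i := (shape t k).1 in
    if (shape t k.-1).1 == i
    then (pF (k - i + 1) - xF * pF (k - i)) * pF i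
    else (pF i - xF * pF i.-1) * pF (k - i + 1).

Definition r_set (k : nat) : seq Fx :=
  undup [seq r_tab t k | mu <- parts k, t <- tableaux k mu].

(* The outer product is taken in increasing order of k. *)
Definition F_elt (n : nat) (t : tableau) : TL xF n :=
  \prod_(2 <= k < n.+1) \prod_(r <- r_set k | r != r_tab t k)
    ((r_tab t k - r)^-1 *: (T_elt xF n k - r%:A)).

Definition f_tab (n : nat) (l : part) (t : tableau) : cell xF n l :=
  cell_act (m_tab xF n l t) (F_elt n t).

Definition dim_part (n : nat) (l : part) : nat := size (tableaux n l).

Definition det_part (n : nat) (l : part) : Fx :=
  \prod_(t <- tableaux n l) cell_form (f_tab n l t) (f_tab n l t).

(* Main.v *)
(* Over F the cell module of shape (f, h) has a second description: paths
   (tableaux) t with heights h_k, where e_k fixes the endpoints of a path,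
   requires h_(k-1) = h_(k+1) = h and has rank one with weights p_(h_k+1)/p_(h+1).
   In this basis z_k acts on paths of shape (i, h) at k by p_i p_(i+h+1), hence
   T_k is diagonal with eigenvalue r_t(k) and F_t projects onto the path t.
   The form with weights prod_k p_(h_k+1) is invariant, and m_lambda acts as x^f
   times the projection onto the path 0,1,0,1,...,0,1,2,...,h, so this form, suitably
   scaled, satisfies the defining relation of the cellular form; the latter is
   unique because the m_t span.  The coefficient of t in the image of m_t is the
   product of 1/p_(h_k+1) over the descents k of t.  Altogether
     <f_t, f_t> = (p_1 ... p_(h+1))^-1 prod_k p_(h_k+1) prod_(descents k) p_(h_k+1)^-2,
   and removing the last step of t divides this by 1 or by p_(h+2)/p_(h+1). *)

From mathcomp Require Import all_boot all_order all_algebra.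
From mathcomp Require Import boolp classical_sets functions.
From mathcomp Require Import zify ring.
(* Last, so that [shape] is the one of tableaux and not [seq.shape]. *)
Require Import Defs.

Set Implicit Arguments.
Unset Strict Implicit.
Unset Printing Implicit Defensive.

Import GRing.Theory.
Local Open Scope ring_scope.

Arguments shape : simpl never.
Arguments pF : simpl never.

(** * Spans and subalgebras of the Temperley-Lieb algebra *)

(** [cell_form] is a chosen form on a quotient of formal terms, so it can be computed only after a
    form with the defining relation has been exhibited and shown to be unique. Uniqueness combines
    two facts from opposite sides: the m_t span, which follows from the relations, and m_lambda is
    nonzero modulo the higher ideals, which the path module shows because these ideals act on it by
    zero.

    With A_k generated by e_1, ..., e_(k-1), spanning rests on the absorption of e_k A_k e_k into
    e_k A_(k-1); it makes every element of A_(k+1) a combination of words with at most one e_k.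

    The image of m_t in the path module is never computed in full: F_t projects onto t, so only the
    coefficient of t matters, and it telescopes.

    All eigenvalue computations come down to p_(i+1) p_(h+i+1) - p_i p_(h+i+2) = p_(h+1). The same
    identity separates the two continuations of a path, and so makes F_t a projection onto one
    path. *)

Section Span.
Variables (K : comNzRingType) (A : algType K).
Implicit Types X Y : A -> Prop.

Inductive lspan X : A -> Prop :=
| lspan0 : lspan X 0
| lspanP k a b of X a & lspan X b : lspan X (k *: a + b).

Lemma lspan_in X a : X a -> lspan X a.
Proof. by move=> Xa; rewrite -[a]scale1r -[_ *: a]addr0; apply/lspanP/lspan0. Qed.

Lemma lspanD X a b : lspan X a -> lspan X b -> lspan X (a + b).
Proof.
by move=> Xa Xb; elim: Xa => [|k u v Xu _ IH]; rewrite ?add0r // -addrA; apply: lspanP.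
Qed.

Lemma lspanZ X k a : lspan X a -> lspan X (k *: a).
Proof.
elim=> [|l u v Xu _ IH]; first by rewrite scaler0; apply: lspan0.
by rewrite scalerDr scalerA; apply: lspanP.
Qed.

Lemma lspan_mul X Y b c a :
    (forall u, X u -> lspan Y (b * u * c)) -> lspan X a -> lspan Y (b * a * c).
Proof.
move=> XY; elim=> [|k u v Xu _ IH]; first by rewrite mulr0 mul0r; apply: lspan0.
rewrite mulrDr mulrDl; apply: lspanD => //.
by rewrite -scalerAr -scalerAl; apply/lspanZ/XY.
Qed.

Lemma lspan_mulr X Y c a :
  (forall u, X u -> lspan Y (u * c)) -> lspan X a -> lspan Y (a * c).
Proof.
move=> XY Xa; rewrite -[a]mul1r; apply: lspan_mul Xa => u Xu.
by rewrite mul1r; apply: XY.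
Qed.

Lemma lspan_mull X Y c a :
  (forall u, X u -> lspan Y (c * u)) -> lspan X a -> lspan Y (c * a).
Proof.
move=> XY Xa; rewrite -[_ * a]mulr1; apply: lspan_mul Xa => u Xu.
by rewrite mulr1; apply: XY.
Qed.

Lemma lspan_bind X Y a : (forall u, X u -> lspan Y u) -> lspan X a -> lspan Y a.
Proof.
move=> XY Xa; rewrite -[a]mul1r; apply: lspan_mull Xa => u Xu.
by rewrite mul1r; apply: XY.
Qed.

End Span.

Section TLRelations.
Variables (K : comNzRingType) (d : K) (n : nat).
Local Notation A := (TL d n).
Local Notation e := (tl_e d n).

Lemma tl_e_sq i : e i * e i = d *: e i.
Proof.
rewrite /tl_e; case: insubP => [j _ _|_]; last by rewrite mulr0 scaler0.
by have [sq _ _] := tl_gen_relations d n; rewrite sq.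
Qed.

Lemma tl_e_braid i j :
  (j == i.+1) || (i == j.+1) -> (0 < j < n)%N -> e i * e j * e i = e i.
Proof.
move=> ij jn; rewrite /tl_e; case: insubP => [i' _ iE|_]; last by rewrite !mul0r.
rewrite insubT; have [_ br _] := tl_gen_relations d n; apply: br.
by rewrite iE SubK.
Qed.

Lemma tl_e_comm i j : (i.+2 <= j)%N || (j.+2 <= i)%N -> e i * e j = e j * e i.
Proof.
move=> ij; rewrite /tl_e; case: insubP => [i' _ iE|_]; last by rewrite mulr0 mul0r.
case: insubP => [j' _ jE|_]; last by rewrite mulr0 mul0r.
by have [_ _ cm] := tl_gen_relations d n; apply: cm; rewrite iE jE.
Qed.

(** Generators are selected by a predicate because both initial and final segments of indices occur.
    Indices outside the range contribute only 0. *)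
Inductive subalg (P : pred nat) : A -> Prop :=
| subalg_scal k : subalg P k%:A
| subalg_gen i of P i : subalg P (e i)
| subalgD a b of subalg P a & subalg P b : subalg P (a + b)
| subalgM a b of subalg P a & subalg P b : subalg P (a * b).

Lemma subalg1 P : subalg P 1.
Proof. by rewrite -[1]scale1r; apply: subalg_scal. Qed.

Lemma subalgW (P Q : pred nat) a : subpred P Q -> subalg P a -> subalg Q a.
Proof.
move=> PQ; elim=> [k|i /PQ|u v _ IHu _ IHv|u v _ IHu _ IHv];
  by [exact: subalg_scal|exact: subalg_gen|exact: subalgD|exact: subalgM].
Qed.

Lemma subalg_prod (P : pred nat) (I : eqType) (s : seq I) F :
  (forall i, i \in s -> subalg P (F i)) -> subalg P (\prod_(i <- s) F i).
Proof.
move=> PF; rewrite big_seq_cond.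
by apply: big_ind => [|a b|i /andP[/PF]]; [exact: subalg1|exact: subalgM|].
Qed.

Lemma subalg_full (a : A) : subalg (fun i => 0 < i < n)%N a.
Proof.
rewrite -[a]reprK; elim: (repr a) => [k|i|u IHu v IHv|u IHu v IHv].
- by rewrite tl_piS; apply: subalg_scal.
- by rewrite -/(tl_gen d i) -tl_eE; apply: subalg_gen; case: (i).
- by rewrite tl_piD; apply: subalgD.
- by rewrite tl_piM; apply: subalgM.
Qed.

Lemma subalg_comm (P : pred nat) a b :
  (forall i, P i -> b * e i = e i * b) -> subalg P a -> b * a = a * b.
Proof.
move=> Pb; elim=> [k|i /Pb//|u v _ IHu _ IHv|u v _ IHu _ IHv].
- by rewrite mulr_algl mulr_algr.
- by rewrite mulrDr mulrDl IHu IHv.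
- by rewrite mulrA IHu -mulrA IHv mulrA.
Qed.

Lemma subalg_stable (P : pred nat) X a b :
    (forall i u, P i -> lspan X u -> lspan X (u * e i)) ->
  subalg P b -> lspan X a -> lspan X (a * b).
Proof.
move=> PX Pb; elim: Pb a => [k|i Pi|u v _ IHu _ IHv|u v _ IHu _ IHv] a Xa.
- by rewrite mulr_algr; apply: lspanZ.
- exact: PX.
- by rewrite mulrDr; apply: lspanD; [apply: IHu|apply: IHv].
- by rewrite mulrA; apply/IHv/IHu.
Qed.

Definition split_at (P : pred nat) k (a : A) : Prop :=
  subalg P a \/ exists b c, [/\ subalg P b, subalg P c & a = b * e k * c].

(** For nested initial segments this is the conditional expectation of the Jones basic
    construction. *)
Definition absorbs (P Q : pred nat) k : Prop :=
  forall a, subalg P a -> exists2 b, subalg Q b & e k * a * e k = e k * b.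

(** A second e_k multiplied on the right creates e_k c e_k, which absorption turns into e_k c'; so
    one e_k always suffices. *)
Lemma absorbs_split (P Q : pred nat) k : absorbs P Q k -> subpred Q P ->
    (forall i, Q i -> (i.+2 <= k)%N || (k.+2 <= i)%N) ->
  forall a, subalg (fun i => P i || (i == k)) a -> lspan (split_at P k) a.
Proof.
move=> ab QP Qk a Pa; rewrite -[a]mul1r; apply: subalg_stable Pa _; last first.
  by apply: lspan_in; left; apply: subalg1.
move=> i u /orP[Pi|/eqP->]; apply: lspan_mulr => {u} u [Pu|[b [c [Pb Pc ->]]]];
  apply: lspan_in.
- by left; apply/subalgM/subalg_gen.
- right; exists b, (c * e i); rewrite mulrA; split=> //; exact/subalgM/subalg_gen.
- by right; exists u, 1; rewrite mulr1; split=> //; apply: subalg1.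
- have [c' Qc' E] := ab c Pc; right; exists b, c'; split=> //.
    exact: subalgW Qc'.
  by rewrite -!(mulrA b) E.
Qed.

(** The step back, at a neighbouring index: a single e_j between factors commuting with e_k
    disappears by e_k e_j e_k = e_k, and without it e_k^2 = d e_k applies. Alternating with
    [absorbs_split] gives the two inductions below. *)
Lemma split_absorbs (P Q : pred nat) j k :
    (forall a, subalg P a -> lspan (split_at Q j) a) ->
    (forall i, Q i -> (i.+2 <= k)%N || (k.+2 <= i)%N) ->
    (j == k.+1) || (k == j.+1) -> (0 < j < n)%N ->
  absorbs P Q k.
Proof.
move=> sp Qk jk jn a /sp.
have cm b : subalg Q b -> e k * b = b * e k.
  by apply: subalg_comm => i /Qk ik; apply: tl_e_comm; rewrite orbC.
elim=> [|l u v]; first by exists 0; rewrite ?mulr0 ?mul0r // -(scale0r 1); apply: subalg_scal.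
move=> Xu _ [b Qb E].
suff [c Qc F]: exists2 c, subalg Q c & e k * u * e k = e k * c.
  exists (l *: c + b).
    by apply: subalgD => //; rewrite -mulr_algl; apply: subalgM => //; apply: subalg_scal.
  by rewrite mulrDr mulrDl E -scalerAr -scalerAl F mulrDr -scalerAr.
case: Xu => [Qu|[b1 [b2 [Q1 Q2 ->]]]].
  exists (d%:A * u); first by apply: subalgM => //; apply: subalg_scal.
  by rewrite -mulrA -(cm u) // mulrA tl_e_sq mulr_algl -scalerAl scalerAr.
exists (b1 * b2); first exact: subalgM.
rewrite !mulrA cm // -!mulrA -(cm b2) // [e j * _]mulrA [e k * (_ * _)]mulrA.
by rewrite [e k * (_ * e k)]mulrA tl_e_braid // -[RHS]mulrA [RHS]mulrA -cm // -mulrA.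
Qed.

Definition itv a b : pred nat := fun i => (a <= i < b)%N.

Lemma absorbs_empty P k : P =1 xpred0 -> absorbs P P k.
Proof.
move=> P0 a; elim=> [l|i|u v _ [b Pb Eu] _ [c Pc Ev]|u v Pu [b Pb Eu] Pv [c Pc Ev]].
- exists (l * d)%:A; first exact: subalg_scal.
  by rewrite !mulr_algr -scalerAl tl_e_sq scalerA.
- by rewrite P0.
- by exists (b + c); [exact: subalgD|rewrite mulrDr mulrDl Eu Ev mulrDr].
- exists (u * c); first exact: subalgM.
  have cm w : subalg P w -> e k * w = w * e k by apply: subalg_comm => i; rewrite P0.
  by rewrite mulrA cm // -[_ * v]mulrA -[LHS]mulrA Ev [u * _]mulrA -cm // mulrA.
Qed.

Lemma absorbs_top k : (k < n)%N -> absorbs (itv 1 k) (itv 1 k.-1) k.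
Proof.
elim: k => [|[|k] IHk] kn.
- by move=> a Pa; apply: (absorbs_empty 0) Pa => i; rewrite /itv; lia.
- move=> a Pa; have I0 : itv 1 1 =1 xpred0 by move=> i; rewrite /itv; lia.
  have [b Pb E] := absorbs_empty 1 I0 Pa.
  by exists b => //; apply: subalgW Pb => i; rewrite /itv; lia.
apply: (@split_absorbs _ _ k.+1) => [a Pa|i||]; rewrite ?eqxx ?orbT //=; first last.
- lia.
- by rewrite /itv; lia.
apply: (absorbs_split (IHk _)) => [||i|]; rewrite /itv /=; try lia.
- by move=> i; lia.
by apply: subalgW Pa => i; rewrite /itv; lia.
Qed.

Lemma split_top k a : (k < n)%N ->
  subalg (itv 1 k.+1) a -> lspan (split_at (itv 1 k) k) a.
Proof.
move=> kn; case: k kn => [|k] kn Pa.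
  by apply: lspan_in; left; apply: subalgW Pa => i; rewrite /itv; lia.
apply: (absorbs_split (absorbs_top kn)) => [i|i|]; rewrite /itv; try lia.
by apply: subalgW Pa => i; rewrite /itv; lia.
Qed.

(** Mirror image of [absorbs_top]: the induction runs downwards from the right end [b]. *)
Lemma absorbs_bottom b k : (b <= n)%N ->
  (0 < k < b)%N -> absorbs (itv k.+1 b) (itv k.+2 b) k.
Proof.
move=> bn; move: {2}(b - k)%N (leqnn (b - k)%N) => m.
elim: m k => [|m IHm] k bk kb; first by move: bk kb; lia.
have [k1b|bk1] := ltnP k.+1 b; last first.
  move=> a Pa; have I0 : itv k.+1 b =1 xpred0 by move=> i; rewrite /itv; lia.
  have [c Pc E] := absorbs_empty k I0 Pa.
  by exists c => //; apply: subalgW Pc => i; rewrite /itv; lia.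
apply: (@split_absorbs _ _ k.+1) => [a Pa|i||]; rewrite ?eqxx ?orbT //=; first last.
- lia.
- by rewrite /itv; lia.
apply: (absorbs_split (IHm k.+1 _ _)) => [|||i|]; rewrite /itv /=; try lia.
- by move=> i; lia.
by apply: subalgW Pa => i; rewrite /itv; lia.
Qed.

(** Here a may itself contain e_k, after splitting at most once; e_k b1 e_k b2 e_k is then absorbed
    twice. *)
Lemma absorbs_bottom_full b k a : (b <= n)%N -> (0 < k < b)%N ->
  subalg (itv k b) a -> exists2 c, subalg (itv k.+2 b) c & e k * a * e k = e k * c.
Proof.
move=> bn kb Pa.
have ab := absorbs_bottom bn kb.
have cm c : subalg (itv k.+2 b) c -> e k * c = c * e k.
  by apply: subalg_comm => i; rewrite /itv => ik; apply: tl_e_comm; lia.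
have: lspan (split_at (itv k.+1 b) k) a.
  apply: (absorbs_split ab) => [i|i|]; rewrite /itv; try lia.
  by apply: subalgW Pa => i; rewrite /itv; lia.
elim=> [|l u v Xu _ [c Pc E]].
  by exists 0; rewrite ?mulr0 ?mul0r // -(scale0r 1); apply: subalg_scal.
suff [c' Qc F]: exists2 c, subalg (itv k.+2 b) c & e k * u * e k = e k * c.
  exists (l *: c' + c).
    by apply: subalgD => //; rewrite -mulr_algl; apply: subalgM => //; apply: subalg_scal.
  by rewrite mulrDr mulrDl E -scalerAr -scalerAl F mulrDr -scalerAr.
case: Xu => [/ab//|[b1 [b2 [/ab[c1 P1 E1] /ab[c2 P2 E2] ->]]]].
exists (c1 * c2); first exact: subalgM.
by rewrite !mulrA E1 cm // -!mulrA [e k * (_ * _)]mulrA E2.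
Qed.

End TLRelations.

(** * The standard words span *)

Lemma arrowP (m l : nat * nat) :
  reflect (l = (m.1, m.2.+1) \/ l = (m.1.+1, m.2.-1) /\ (0 < m.2)%N) (arrow m l).
Proof.
case: m l => [i h] [j g]; apply: (iffP orP) => /=.
  by case=> /andP[/eqP-> /eqP gh]; [left|right; split; last lia];
     congr pair; lia.
by case=> [[-> ->]|[[-> ->] h0]]; [left|right]; rewrite eqxx /=; lia.
Qed.

Lemma tableauP n l (t : seq (nat * nat)) :
  reflect [/\ size t = n.+1, shape t 0 = (0, 0)%N, shape t n = l
            & forall k, (k < n)%N -> arrow (shape t k) (shape t k.+1)]
          (t \in tableaux n l).
Proof.
rewrite mem_tableaux; apply: (iffP and5P).
  case=> /eqP st /eqP t0 /eqP tn _ /allP ta; split=> // k kn.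
  by apply: ta; rewrite mem_iota.
case=> st t0 tn ta; split; rewrite ?st ?t0 ?tn //.
  apply/allP => k; rewrite mem_iota => /andP[_].
  elim: k => [|k IHk] kn; first by rewrite t0.
  have := IHk (ltnW kn); rewrite /is_part.
  by case/arrowP: (ta k kn) => [->|[-> ?]] /=; lia.
by apply/allP => k; rewrite mem_iota => /andP[_]; apply: ta.
Qed.

Lemma tableau_part n l t k :
  t \in tableaux n l -> (k <= n)%N -> is_part k (shape t k).
Proof.
rewrite mem_tableaux => /and5P[_ _ _ /allP tp _] kn; apply: tp.
by rewrite mem_iota.
Qed.

Lemma tableau_rcons k m l s :
  s \in tableaux k m -> arrow m l -> rcons s l \in tableaux k.+1 l.
Proof.
move=> sm ml; rewrite mem_tableaux is_tableauS eqxx /=.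
have /tableauP[_ _ sk _] := sm; rewrite sk ml -mem_tableaux sm andbT.
have := tableau_part sm (leqnn k); rewrite sk /is_part.
by case/arrowP: ml => [->|[-> ?]] /=; lia.
Qed.

Lemma tableau_rconsP k l t : t \in tableaux k.+1 l ->
  exists2 s, t = rcons s l & arrow (shape s k) l /\ s \in tableaux k (shape s k).
Proof.
case/lastP: t => [|s m]; first by case/tableauP.
rewrite mem_tableaux is_tableauS => /and4P[/eqP-> _ ar ts]; exists s => //.
by rewrite mem_tableaux.
Qed.

Lemma shape_rcons s l k : (k < size s)%N -> shape (rcons s l) k = shape s k.
Proof. by move=> ks; rewrite /shape nth_rcons ks. Qed.

Lemma shape_rcons_last s l k : size s = k -> shape (rcons s l) k = l.
Proof. by move=> <-; rewrite /shape nth_rcons ltnn eqxx. Qed.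

Section VRcons.
Variables (K : comNzRingType) (d : K) (n : nat).

Lemma v_uptoS t k : v_upto d n t k.+1 =
  if (shape t k).1 == (shape t k.+1).1 then v_upto d n t k
  else w_elt d n (2 * (shape t k.+1).1) k.+1 * v_upto d n t k.
Proof. by []. Qed.

Lemma eq_v_upto s t k : (forall j, (j <= k)%N -> shape s j = shape t j) ->
  v_upto d n s k = v_upto d n t k.
Proof.
elim: k => // k IHk st; rewrite !v_uptoS !st // IHk // => j jk.
by apply: st; apply: leqW.
Qed.

Lemma v_upto_rcons s l k : size s = k.+1 ->
  v_upto d n (rcons s l) k.+1 =
  if (shape s k).1 == l.1 then v_upto d n s k
  else w_elt d n (2 * l.1) k.+1 * v_upto d n s k.
Proof.
move=> sk; rewrite v_uptoS (shape_rcons_last _ sk) shape_rcons ?sk //.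
by rewrite (@eq_v_upto _ s) // => j jk; rewrite shape_rcons // sk.
Qed.

Lemma w_eltE i j : (i <= j)%N ->
  w_elt d n i j = \prod_(i <= k < j) tl_e d n k.
Proof.
rewrite /w_elt leq_eqVlt => /predU1P[->|->//].
by rewrite ltnn subnn /= big_nil big_geq.
Qed.

Lemma w_subalg i k : (0 < i <= k)%N -> subalg (itv i k) (w_elt d n i k).
Proof.
move=> /andP[i0 ik]; rewrite w_eltE //; apply: subalg_prod => j.
by rewrite mem_index_iota => ijk; apply: subalg_gen.
Qed.

Lemma v_upto_subalg l t m k : t \in tableaux m l -> (k <= m)%N ->
  subalg (itv 1 k) (v_upto d n t k).
Proof.
move=> tm; elim: k => [|k IHk] km; first exact: subalg1.
rewrite v_uptoS.
have /tableauP[_ _ _ ta] := tm.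
have IH : subalg (itv 1 k.+1) (v_upto d n t k).
  by apply: subalgW (IHk (ltnW km)) => j; rewrite /itv; lia.
case: ifP => // ne; apply: subalgM => //.
have := tableau_part tm km; move: ne.
case/arrowP: (ta k km) => [->|[-> _]] /=; first by rewrite eqxx.
rewrite /is_part /= => _ pk.
by apply: subalgW (w_subalg _) => [j|]; rewrite /itv; lia.
Qed.

End VRcons.

Section Spanning.
Variables (K : fieldType) (d : K) (n : nat).
Local Notation A := (TL d n).
Local Notation e := (tl_e d n).
Local Notation G k := (subalg (d := d) (n := n) (itv 1 k)).

Definition arcs f : A := \prod_(0 <= j < f) e (2 * j).+1.

Lemma arcsS f : arcs f.+1 = arcs f * e (2 * f).+1.
Proof. by rewrite /arcs big_nat_recr. Qed.

Lemma arcs_subalg f k : (2 * f <= k)%N -> G k (arcs f).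
Proof.
move=> fk; apply: subalg_prod => j; rewrite mem_index_iota => jf.
by apply: subalg_gen; rewrite /itv; lia.
Qed.

Lemma arcs_comm f k a :
  subalg (itv (2 * f).+1 k) a -> arcs f * a = a * arcs f.
Proof.
apply: subalg_comm => i ik; apply/esym.
apply: (subalg_comm _ (arcs_subalg (leqnn _))) => j jk.
by apply: tl_e_comm; move: ik jk; rewrite /itv; lia.
Qed.

Lemma arcs_e_comm f j : (2 * f < j)%N -> arcs f * e j = e j * arcs f.
Proof.
move=> fj; apply: (@arcs_comm f j.+1); apply: subalg_gen.
by rewrite /itv; lia.
Qed.

Lemma arcs_sq f : arcs f * arcs f = d ^+ f *: arcs f.
Proof.
elim: f => [|f IHf]; first by rewrite /arcs big_nil mul1r scale1r.
rewrite arcsS mulrA -[arcs f * _ * arcs f]mulrA -arcs_e_comm //.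
rewrite mulrA IHf -!scalerAl -mulrA tl_e_sq -scalerAr scalerA.
by rewrite exprSr.
Qed.

Lemma arcs_absorb f k a : (k <= n)%N -> (2 * f <= k)%N -> G k a ->
  exists2 b, subalg (itv (2 * f).+1 k) b & arcs f * a * arcs f = arcs f * b.
Proof.
move=> kn; elim: f => [|f IHf] fk Ga.
  by exists a; rewrite // /arcs big_nil mulr1.
have [|b Gb E] := IHf _ Ga; first lia.
have [|c Gc F] := absorbs_bottom_full (k := (2 * f).+1) kn _ Gb; first lia.
exists c; first by rewrite mulnS.
rewrite arcsS -[RHS]mulrA -F.
have -> : arcs f * e (2 * f).+1 * a * (arcs f * e (2 * f).+1) =
    e (2 * f).+1 * (arcs f * a * arcs f) * e (2 * f).+1.
  by rewrite {1}arcs_e_comm // !mulrA.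
by rewrite E mulrA -arcs_e_comm // -!mulrA.
Qed.

Definition ideal_word k j (y : A) : Prop :=
  (2 * j <= k)%N /\ exists a b, [/\ G k a, G k b & y = a * arcs j * b].

Lemma ideal_word_mul k j y a b :
  G k a -> G k b -> lspan (ideal_word k j) y -> lspan (ideal_word k j) (a * y * b).
Proof.
move=> Ga Gb; apply: lspan_mul => u [jk [a' [b' [Ga' Gb' ->]]]].
apply: lspan_in; split=> //; exists (a * a'), (b' * b).
by split; [exact: subalgM|exact: subalgM|rewrite !mulrA].
Qed.

(** For j = 2f+1 the product is the next [arcs]. A larger index is lowered by e_(j+1) = e_(j+1) e_j
    e_(j+1), whose left factor commutes past the arcs. *)
Lemma arcs_e f j k : (k <= n)%N -> (2 * f < j < k)%N ->
  lspan (ideal_word k f.+1) (arcs f * e j).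
Proof.
move=> kn; elim: j => [|j IHj] fj; first lia.
have [jf|] := eqVneq j (2 * f)%N.
  apply: lspan_in; split; first lia.
  by exists 1, 1; rewrite mul1r mulr1 arcsS jf; split=> //; apply: subalg1.
move=> jf; rewrite -(@tl_e_braid _ _ _ j.+1 j) ?eqxx ?orbT //; last lia.
rewrite !mulrA arcs_e_comm; last lia.
rewrite -[_ * _ * e j]mulrA; apply: ideal_word_mul; last by apply: IHj; lia.
- by apply: subalg_gen; rewrite /itv; lia.
- by apply: subalg_gen; rewrite /itv; lia.
Qed.

(** Modulo the next ideal every e_j with j > 2f kills the arcs, so only the constant term of b
    survives. *)
Lemma arcs_scal f k b : (k <= n)%N -> subalg (itv (2 * f).+1 k) b ->
  exists c : K, lspan (ideal_word k f.+1) (arcs f * b - c *: arcs f).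
Proof.
move=> kn; elim=> [c|j fj|u v _ [c Iu] _ [c' Iv]|u v _ [c Iu] Gv [c' Iv]].
- by exists c; rewrite mulr_algr subrr; apply: lspan0.
- by exists 0; rewrite scale0r subr0; apply: arcs_e.
- exists (c + c'); rewrite mulrDr scalerDl opprD addrACA.
  exact: lspanD.
exists (c * c').
have -> : arcs f * (u * v) - c * c' *: arcs f =
    (arcs f * u - c *: arcs f) * v + c *: (arcs f * v - c' *: arcs f).
  rewrite mulrBl scalerBr scalerA mulrA -scalerAl addrA.
  by rewrite [_ - _ + _]addrNK.
apply: lspanD; last exact: lspanZ.
rewrite -[_ * v]mul1r mulrA; apply: ideal_word_mul Iu; first exact: subalg1.
by apply: subalgW Gv => j; rewrite /itv; lia.
Qed.

(** For k = n and a = v_s v_t^* the scalar is the value required of the cellular form. The same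
    collapse drives the spanning argument. *)
Lemma arcs_cellular f k a : (k <= n)%N -> (2 * f <= k)%N -> G k a ->
  exists c : K, lspan (ideal_word k f.+1) (arcs f * a * arcs f - c *: arcs f).
Proof.
move=> kn fk Ga; have [b Gb ->] := arcs_absorb kn fk Ga.
exact: arcs_scal Gb.
Qed.

Definition standard_word k f (y : A) : Prop :=
  exists2 t, t \in tableaux k (f, k - 2 * f)%N & y = arcs f * v_upto d n t k.

Definition standard_or_above k f (y : A) : Prop :=
  standard_word k f y \/ ideal_word k f.+1 y.

Lemma ideal_wordW k k' f y : (k <= k')%N -> ideal_word k f y -> ideal_word k' f y.
Proof.
move=> kk' [fk [a [b [Ga Gb ->]]]]; split; first lia.
by exists a, b; split=> //; [apply: subalgW Ga|apply: subalgW Gb] => i; rewrite /itv; lia.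
Qed.

Lemma standard_wordW k f y : (2 * f <= k)%N ->
  standard_word k f y -> standard_word k.+1 f y.
Proof.
move=> fk [t tk ->]; exists (rcons t (f, k.+1 - 2 * f)%N).
  by apply: tableau_rcons tk _; apply/arrowP; left; rewrite /= subSn.
have /tableauP[st _ stk _] := tk.
by rewrite v_upto_rcons // stk eqxx.
Qed.

Lemma standard_or_aboveW k f y : (2 * f <= k)%N ->
  lspan (standard_or_above k f) y -> lspan (standard_or_above k.+1 f) y.
Proof.
move=> fk; apply: lspan_bind => u [Su|Iu]; apply: lspan_in.
  by left; apply: standard_wordW.
by right; apply: ideal_wordW Iu.
Qed.

Lemma ideal_standard k f y :
  lspan (ideal_word k f.+1) y -> lspan (standard_or_above k f) y.
Proof. by apply: lspan_bind => u Iu; apply: lspan_in; right. Qed.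

Lemma standard_word_down k f t : (2 * f.+1 <= k.+1)%N ->
  t \in tableaux k (f, k - 2 * f)%N ->
  standard_word k.+1 f.+1
    (arcs f.+1 * (w_elt d n (2 * f.+1) k.+1 * v_upto d n t k)).
Proof.
move=> fk tk; exists (rcons t (f.+1, k.+1 - 2 * f.+1)%N).
  apply: tableau_rcons tk _; apply/arrowP; right; split=> /=; last lia.
  by congr pair; lia.
have /tableauP[st _ stk _] := tk.
by rewrite v_upto_rcons // stk /= eqn_leq ltnn andbF.
Qed.

(** The factor [arcs f] of [arcs f.+1] passes through w, whose indices are at least 2f+2, and stands
    next to whatever follows; there the spanning statement for f applies. *)
Lemma arcs_w f k : (2 * f.+1 <= k)%N -> exists2 c,
  arcs f * c = c * arcs f & arcs f.+1 * w_elt d n (2 * f.+1) k = c * arcs f.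
Proof.
move=> fk; exists (e (2 * f).+1 * w_elt d n (2 * f.+1) k); last first.
  rewrite -(@arcs_comm f k) ?arcsS ?mulrA //; apply: subalgM.
    by apply: subalg_gen; rewrite /itv; lia.
  by apply: subalgW (w_subalg d n _) => [i|]; rewrite /itv; lia.
apply: (@arcs_comm f k); apply: subalgM.
  by apply: subalg_gen; rewrite /itv; lia.
by apply: subalgW (w_subalg d n _) => [i|]; rewrite /itv; lia.
Qed.

Lemma arcs0 : arcs 0 = 1. Proof. by rewrite /arcs big_geq. Qed.

Lemma standard_word1 k : standard_word k 0 1.
Proof.
elim: k => [|k IHk]; first by exists [:: (0, 0)%N]; rewrite ?inE // arcs0 mulr1.
exact: standard_wordW.
Qed.

Hypothesis d0 : d != 0.

(* [d != 0] lets one replace [arcs f] by [d ^- f *: (arcs f * arcs f)]. *)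
Lemma spanning_down k f a : (k < n)%N -> (2 * f.+1 <= k.+1)%N ->
    (forall b, G k b -> lspan (standard_or_above k f) (arcs f * b)) ->
    ((2 * f.+1 <= k)%N ->
      forall b, G k b -> lspan (standard_or_above k f.+1) (arcs f.+1 * b)) ->
  G k a ->
  lspan (standard_or_above k.+1 f.+1) (arcs f.+1 * (w_elt d n (2 * f.+1) k.+1 * a)).
Proof.
move=> kn fk IHf IHf1 Ga.
have [c cm cE] := arcs_w fk.
set w := w_elt _ _ _ _ in cE *.
have -> : arcs f.+1 * (w * a) = d ^- f *: (arcs f.+1 * w * (arcs f * a)).
  rewrite cE -[c * _ * _]mulrA [arcs f * (_ * _)]mulrA arcs_sq.
  rewrite -scalerAl -scalerAr scalerA mulVf ?expf_neq0 // scale1r.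
  by rewrite [LHS]mulrA cE mulrA.
apply/lspanZ/(lspan_mull _ (IHf a Ga)) => {Ga a} y [[t tk ->]|[fk' [a [b [Ga Gb ->]]]]].
  have -> : arcs f.+1 * w * (arcs f * v_upto d n t k) =
            d ^+ f *: (arcs f.+1 * (w * v_upto d n t k)).
    rewrite cE -[LHS]mulrA [arcs f * (_ * _)]mulrA arcs_sq.
    by rewrite -scalerAl -scalerAr [c * _]mulrA -cE -mulrA.
  by apply/lspanZ/lspan_in; left; apply: standard_word_down.
(* A word of the higher ideal puts [arcs f.+1] on both sides of w a, so modulo the ideal of
   [arcs f.+2] it collapses to a scalar times [arcs f.+1 * b]. *)
have [|c' Ic] := @arcs_cellular f.+1 k.+1 (w * a) kn fk.
  apply: subalgM; last by apply: subalgW Ga => i; rewrite /itv; lia.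
  by apply: subalgW (w_subalg d n _) => [i|]; rewrite /itv; lia.
have -> : arcs f.+1 * w * (a * arcs f.+1 * b) =
    (arcs f.+1 * (w * a) * arcs f.+1 - c' *: arcs f.+1) * b + c' *: (arcs f.+1 * b).
  by rewrite mulrBl -scalerAl addrNK !mulrA.
apply: lspanD; last first.
  by apply/lspanZ/standard_or_aboveW => //; apply: IHf1.
apply: ideal_standard; rewrite -[_ * b]mul1r mulrA.
apply: ideal_word_mul Ic; first exact: subalg1.
by apply: subalgW Gb => i; rewrite /itv; lia.
Qed.

(** By [split_top] e_k occurs at most once in a, and what precedes it expands in standard words of
    A_k; everything depends on how e_k meets the last step of such a word. *)
Lemma spanning k f a : (k <= n)%N -> (2 * f <= k)%N -> G k a ->
  lspan (standard_or_above k f) (arcs f * a).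
Proof.
elim: k f a => [|k IHk] f a kn fk Ga.
  have -> : f = 0 by lia.
  rewrite arcs0 mul1r; rewrite -[a]mul1r; apply: subalg_stable Ga _.
    by move=> i u; rewrite /itv; lia.
  by apply: lspan_in; left; apply: standard_word1.
case: f fk => [_|f fk].
  rewrite -[_ * a]mulr1 -mulrA.
  have [c I] : exists c : K, lspan (ideal_word k.+1 1) (arcs 0 * a - c *: arcs 0).
    by apply: arcs_scal => //; apply: subalgW Ga => i; rewrite /itv; lia.
  rewrite mulr1; have -> : arcs 0 * a = (arcs 0 * a - c *: arcs 0) + c *: arcs 0.
    by rewrite addrNK.
  apply: lspanD; first exact: ideal_standard.
  by apply/lspanZ/lspan_in; left; rewrite arcs0; apply: standard_word1.
have IHf b : G k b -> lspan (standard_or_above k f) (arcs f * b).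
  by apply: IHk; lia.
have IHf1 : (2 * f.+1 <= k)%N ->
    forall b, G k b -> lspan (standard_or_above k f.+1) (arcs f.+1 * b).
  by move=> fk1 b; apply: IHk; lia.
have Gk b : G k b -> G k.+1 b by apply: subalgW => i; rewrite /itv; lia.
have Gek : G k.+1 (e k) by apply: subalg_gen; rewrite /itv; lia.
have := split_top kn Ga.
(* If 2f+2 = k+1, there is no partition of k with first entry f+1. Then [arcs f.+1] ends in e_k
   itself, which absorbs the other e_k, and w is the empty product. *)
have [fk1|kf] := leqP (2 * f.+1)%N k; last first.
  have arcs1 b : G k b -> lspan (standard_or_above k.+1 f.+1) (arcs f.+1 * b).
    move=> Gb; rewrite -[b]mul1r.
    have <- : w_elt d n (2 * f.+1) k.+1 = 1 by rewrite w_eltE ?big_geq //; lia.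
    exact: spanning_down.
  apply: lspan_mull => {Ga a} a [/arcs1//|[b [c [Gb Gc ->]]]].
  have [b' Gb' E] := absorbs_top kn Gb.
  have -> : arcs f.+1 * (b * e k * c) = arcs f.+1 * (b' * c).
    have -> : arcs f.+1 = arcs f * e k by rewrite arcsS; congr (_ * e _); lia.
    by rewrite !mulrA -(mulrA (arcs f)) -(mulrA (arcs f)) E !mulrA.
  apply: arcs1; apply: subalgM => //; apply: subalgW Gb' => i; rewrite /itv; lia.
apply: lspan_mull => {Ga a} a [Ga|[b [c [Gb Gc ->]]]].
  by apply: standard_or_aboveW => //; apply: IHf1.
rewrite !mulrA -mulrA; apply: lspan_mulr (IHf1 fk1 b Gb) => y.
case=> [[t tk ->]|[fk' [a' [b' [Ga' Gb' ->]]]]]; last first.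
  apply: lspan_in; right; split; first lia.
  exists a', (b' * (e k * c)); split; [exact: Gk| |by rewrite !mulrA].
  by apply: subalgM; [exact: Gk|apply: subalgM => //; exact: Gk].
case: k => // k in IHk kn fk IHf IHf1 Gk Gek fk1 b c Gb Gc tk *.
have [s -> [sl ts]] := tableau_rconsP tk.
have /tableauP[ss _ _ _] := ts.
have Gv := v_upto_subalg d n ts (leqnn k).
have vc : v_upto d n s k * e k.+1 = e k.+1 * v_upto d n s k.
  apply/esym; apply: (subalg_comm _ Gv) => i; rewrite /itv => ik.
  by apply: tl_e_comm; lia.
have Gvc : G k.+1 (v_upto d n s k * c).
  by apply: subalgM => //; apply: subalgW Gv => i; rewrite /itv; lia.
have pk := tableau_part ts (leqnn k).
(* Last step up: e_(k+1) commutes past v_s, meets the arcs and falls into the higher ideal. Last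
   step down: e_(k+1) lengthens w by one letter. *)
rewrite v_upto_rcons //; case/arrowP: sl pk => [[]|[[]]] /= s1 s2.
  rewrite -s1 eqxx /is_part -s1 => pk.
  rewrite -mulrA [v_upto _ _ _ _ * (_ * _)]mulrA vc -[e _ * _ * _]mulrA [arcs _ * _]mulrA.
  apply: ideal_standard; rewrite -[_ * e _]mul1r; apply: ideal_word_mul.
  - exact: subalg1.
  - exact: Gk.
  - by apply: arcs_e => //; lia.
move=> h0 pk; rewrite -s1 eqn_leq ltnn andbF.
have -> : arcs f.+1 * (w_elt d n (2 * f.+1) k.+1 * v_upto d n s k) * (e k.+1 * c) =
    arcs f.+1 * (w_elt d n (2 * f.+1) k.+2 * (v_upto d n s k * c)).
  have -> : w_elt d n (2 * f.+1) k.+2 = w_elt d n (2 * f.+1) k.+1 * e k.+1.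
    by rewrite !w_eltE; [apply: big_nat_recr| |]; lia.
  by rewrite -!mulrA; do 2 congr (_ * _); rewrite !mulrA vc.
exact: spanning_down.
Qed.

End Spanning.

(** * Right actions of the Temperley-Lieb algebra *)

Section Action.
Variables (K : comNzRingType) (d : K) (n : nat) (V : lmodType K).
Variable E : tl_index n -> V -> V.
Hypothesis E_linear : forall i, linear (E i).
Hypothesis E_sq : forall i v, E i (E i v) = d *: E i v.
Hypothesis E_braid : forall (i j : tl_index n) v,
  (val j == (val i).+1) || (val i == (val j).+1) -> E i (E j (E i v)) = E i v.
Hypothesis E_comm : forall (i j : tl_index n) v,
  ((val i).+2 <= val j)%N -> E i (E j v) = E j (E i v).

Fixpoint tl_term_act (a : tl_term K n) (v : V) : V :=
  match a with
  | TLscal k => k *: v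
  | TLgen i => E i v
  | TLadd a1 a2 => tl_term_act a1 v + tl_term_act a2 v
  | TLmul a1 a2 => tl_term_act a2 (tl_term_act a1 v)
  end.

Lemma tl_term_act_linear a : linear (tl_term_act a).
Proof.
elim: a => [k|i|a IHa b IHb|a IHa b IHb] l u v /=.
- by rewrite scalerDr !scalerA mulrC.
- exact: E_linear.
- by rewrite IHa IHb scalerDr addrACA.
- by rewrite IHa IHb.
Qed.

Lemma tl_term_act_eq a b : tl_eq d a b -> tl_term_act a =1 tl_term_act b.
Proof.
have ZE c k v : tl_term_act c (k *: v) = k *: tl_term_act c v.
  have c0 : tl_term_act c 0 = 0.
    have := tl_term_act_linear c (-1) 0 0.
    by rewrite !scaleN1r oppr0 addr0 addNr.
  by have := tl_term_act_linear c k v 0; rewrite addr0 c0 addr0.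
have DE c u v : tl_term_act c (u + v) = tl_term_act c u + tl_term_act c v.
  by have := tl_term_act_linear c 1 u v; rewrite !scale1r.
elim=> //=.
- by move=> a1 b1 _ ab v; rewrite ab.
- by move=> b1 a1 c1 _ ab _ bc v; rewrite ab.
- by move=> a1 a2 b1 b2 _ ab _ ab' v; rewrite ab ab'.
- by move=> a1 a2 b1 b2 _ ab _ ab' v; rewrite ab ab'.
- by move=> ? ? ? v; rewrite addrA.
- by move=> ? ? v; rewrite addrC.
- by move=> ? v; rewrite scale0r add0r.
- by move=> a1 v; rewrite ZE scaleN1r addNr scale0r.
- by move=> ? v; rewrite scale1r.
- by move=> ? ? ? v; rewrite DE.
- by move=> k l v; rewrite scalerDl.
- by move=> k l v; rewrite scalerA mulrC.
- by move=> k ? v; rewrite ZE.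
- by move=> i v; rewrite E_sq -[RHS]/(tl_term_act (TLgen i) (d *: v)) ZE.
- by move=> i j ij v; apply: E_braid.
- by move=> i j /orP[] ij v; rewrite (E_comm v ij).
Qed.

Definition tl_act (u : TL d n) (v : V) : V := tl_term_act (repr u) v.

Lemma tl_act_pi a v : tl_act (\pi a)%qT v = tl_term_act a v.
Proof. exact/tl_term_act_eq/tl_reprP. Qed.

Lemma tl_act_linear u : linear (tl_act u).
Proof. exact: tl_term_act_linear. Qed.

Lemma tl_actM a b v : tl_act (a * b) v = tl_act b (tl_act a v).
Proof. by rewrite -[a]reprK -[b]reprK -tl_piM !tl_act_pi. Qed.

Lemma tl_actD a b v : tl_act (a + b) v = tl_act a v + tl_act b v.
Proof. by rewrite -[a]reprK -[b]reprK -tl_piD !tl_act_pi. Qed.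

Lemma tl_act_scal k v : tl_act k%:A v = k *: v.
Proof. by rewrite -tl_piS tl_act_pi. Qed.

Lemma tl_actZ k a v : tl_act (k *: a) v = k *: tl_act a v.
Proof. by rewrite -mulr_algr tl_actM tl_act_scal. Qed.

Lemma tl_act1 v : tl_act 1 v = v.
Proof. by rewrite -[1]scale1r tl_act_scal scale1r. Qed.

Lemma tl_act_gen i v : tl_act (tl_gen d i) v = E i v.
Proof. by rewrite tl_act_pi. Qed.

Lemma tl_act_star (B : V -> V -> K) : bilinear_for *%R *%R B ->
    (forall i u v, B (E i u) v = B u (E i v)) ->
  forall a u v, B (tl_act a u) v = B u (tl_act (tl_star a) v).
Proof.
move=> [Bl Br] BE a u v; rewrite -[a]reprK tl_star_pi !tl_act_pi.
have Bl0 w : B 0 w = 0.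
  by have /= := Bl w (-1) 0 0; rewrite !scaleN1r oppr0 addr0 mulN1r addNr.
have Br0 w : B w 0 = 0.
  by have /= := Br w (-1) 0 0; rewrite !scaleN1r oppr0 addr0 mulN1r addNr.
elim: (repr a) u v => [k|i|b IHb c IHc|b IHb c IHc] u v /=.
- have /= := Bl v k u 0; have /= := Br u k v 0.
  by rewrite !addr0 Bl0 Br0 !addr0 => -> ->.
- exact: BE.
- have := Bl v 1 (tl_term_act b u) (tl_term_act c u).
  have /= := Br u 1 (tl_term_act (tl_rev b) v) (tl_term_act (tl_rev c) v).
  by rewrite !scale1r !mul1r => -> ->; rewrite IHb IHc.
- by rewrite IHc IHb.
Qed.

End Action.

(** * The polynomials p_i in the fraction field *)

Lemma pFS i : pF i.+2 = xF * pF i.+1 - pF i.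
Proof. by []. Qed.

(** The p_i before passing to fractions, where their degree i - 1 shows that they are nonzero for i
    > 0. *)
Fixpoint cheb_poly (i : nat) : {poly int} :=
  match i with
  | 0%N => 0
  | 1%N => 1
  | (i''.+1 as i').+1 => 'X * cheb_poly i' - cheb_poly i''
  end.

Lemma size_cheb_poly i : size (cheb_poly i) = i.
Proof.
elim/ltn_ind: i => -[|[|i]] IH; rewrite ?size_poly0 ?size_poly1 //.
rewrite -[cheb_poly _]/('X * cheb_poly i.+1 - cheb_poly i).
have p0 : cheb_poly i.+1 != 0 by rewrite -size_poly_eq0 IH.
by rewrite mulrC size_polyDl size_mulX ?IH // size_polyN IH.
Qed.

Lemma pF_cheb i : pF i = tofrac (cheb_poly i).
Proof.
elim/ltn_ind: i => -[|[|i]] IH; rewrite ?rmorph0 ?rmorph1 //.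
by rewrite pFS !IH // -rmorphM -rmorphB.
Qed.

Lemma pF_neq0 i : pF i.+1 != 0.
Proof. by rewrite pF_cheb tofrac_eq0 -size_poly_eq0 size_cheb_poly. Qed.

Lemma xF_neq0 : xF != 0.
Proof. by have := pF_neq0 1; rewrite pFS mulr1 subr0. Qed.

(** The difference of the two products is the determinant of two solutions of the recurrence p_(j+2)
    = x p_(j+1) - p_j, hence independent of i; at i = 0 it is p_(h+1). *)
Lemma pF_det h i :
  pF i.+1 * pF (h + i).+1 = pF i * pF (h + i).+2 + pF h.+1.
Proof.
elim: i => [|i IHi]; first by rewrite addn0 mul1r mul0r add0r.
rewrite addnS (pFS i) (pFS (h + i).+1).
have -> : pF h.+1 = pF i.+1 * pF (h + i).+1 - pF i * pF (h + i).+2.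
  by rewrite IHi addrC addKr.
by ring.
Qed.

(** * The path module *)

Definition set_shape (t : seq (nat * nat)) k y := set_nth (0, 0)%N t k y.

Lemma shape_set t k y j :
  shape (set_shape t k y) j = if j == k then y else shape t j.
Proof. by rewrite /shape nth_set_nth /=; case: eqP. Qed.

Section PathModule.
Variables (n : nat) (l : nat * nat).
Local Notation tab := (tableaux n l).
Local Notation V := (seq (nat * nat) -> Fx^o).
Implicit Types (t s : seq (nat * nat)) (phi psi : V).

Lemma tab_eq s t : s \in tab -> t \in tab ->
  (forall j, (j <= n)%N -> shape s j = shape t j) -> s = t.
Proof.
move=> /tableauP[ss _ _ _] /tableauP[st _ _ _] e.
apply: (@eq_from_nth _ (0, 0)%N); first by rewrite ss st.
by move=> j; rewrite ss => jn; apply: e.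
Qed.

Definition off k s t := forall j, j != k -> shape s j = shape t j.

Lemma tab_eq_off k s t : s \in tab -> t \in tab ->
  off k s t -> shape s k = shape t k -> s = t.
Proof.
move=> sT tT st e; apply: tab_eq => // j _.
by have [->|/st] := eqVneq j k.
Qed.

Lemma off_set k t y : off k (set_shape t k y) t.
Proof. by move=> j /negPf jk; rewrite shape_set jk. Qed.

Lemma set_tab t k y : t \in tab -> (k.+1 < n)%N ->
    arrow (shape t k) y -> arrow y (shape t k.+2) ->
  set_shape t k.+1 y \in tab.
Proof.
move=> /tableauP[st t0 tn ta] kn a1 a2; apply/tableauP; split.
- by rewrite size_set_nth st; lia.
- by rewrite shape_set.
- by rewrite shape_set; case: eqP => // nk; lia.
move=> j jn; rewrite !shape_set.
have [->|jk] := eqVneq j k.+1; first by rewrite gtn_eqF.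
by rewrite eqSS; have [->|_] := eqVneq j k; rewrite // ta.
Qed.

(** One step up and one down between k and k+2, in either order: the place where e_(k+1) can be
    nonzero. Positions are thus one less than the index of the generator. *)
Definition turns t k :=
  shape t k.+2 == ((shape t k).1.+1, (shape t k).2) :> nat * nat.
Definition up t k := set_shape t k.+1 ((shape t k).1, (shape t k).2.+1).
Definition dn t k := set_shape t k.+1 ((shape t k).1.+1, (shape t k).2.-1).

Lemma turns_lt t k : t \in tab -> turns t k -> (k.+1 < n)%N.
Proof.
move=> /tableauP[st _ _ _] /eqP e; rewrite ltnNge; apply/negP => nk.
by move: e; rewrite /shape nth_default // st; lia.
Qed.

Lemma up_tab t k : t \in tab -> turns t k -> up t k \in tab.
Proof.
move=> tT tk; apply: set_tab => //; first exact: turns_lt tk.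
  by apply/arrowP; left.
by rewrite (eqP tk); apply/arrowP; right.
Qed.

Lemma dn_tab t k : t \in tab -> turns t k -> (0 < (shape t k).2)%N -> dn t k \in tab.
Proof.
move=> tT tk h0; apply: set_tab => //; first exact: turns_lt tk.
  by apply/arrowP; right.
by rewrite (eqP tk); apply/arrowP; left; rewrite /= prednK.
Qed.

Lemma off_turns t s k : off k.+1 s t -> turns s k = turns t k.
Proof. by move=> st; rewrite /turns !st //; apply/eqP; lia. Qed.

Lemma off_up t s k : off k.+1 s t -> s \in tab -> t \in tab -> turns t k ->
  up s k = up t k.
Proof.
move=> st sT tT tk; have sk : turns s k by rewrite (off_turns st).
apply: (tab_eq_off (k := k.+1)); rewrite ?up_tab //.
  by move=> j jk; rewrite !off_set ?st.
by rewrite !shape_set eqxx st //; apply/eqP; lia.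
Qed.

Lemma off_dn t s k : off k.+1 s t -> s \in tab -> t \in tab -> turns t k ->
  (0 < (shape t k).2)%N -> dn s k = dn t k.
Proof.
move=> st sT tT tk h0; have sk : turns s k by rewrite (off_turns st).
have e : shape s k = shape t k by apply: st; apply/eqP; lia.
apply: (tab_eq_off (k := k.+1)); rewrite ?dn_tab ?e //.
  by move=> j jk; rewrite !off_set ?st.
by rewrite !shape_set eqxx e.
Qed.

Lemma up_or_dn t k : t \in tab -> turns t k ->
  t = up t k \/ (0 < (shape t k).2)%N /\ t = dn t k.
Proof.
move=> tT tk; have kn := turns_lt tT tk.
have /tableauP[_ _ _ ta] := tT.
case/arrowP: (ta k (ltnW kn)) => [e|[e h0]]; [left|right; split=> //];
  apply: (tab_eq_off (k := k.+1)); rewrite ?up_tab ?dn_tab //.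
- by move=> j jk; rewrite off_set.
- by rewrite shape_set eqxx.
- by move=> j jk; rewrite off_set.
- by rewrite shape_set eqxx.
Qed.

(* The right action of e_(k+1) on row vectors of coefficients indexed by the
   tableaux. When the height of [t] at [k] is 0 the path [dn t k] does not
   exist, and its weight [pF 0] vanishes. *)
Definition path_e k (phi : V) : V := fun t =>
  if (t \in tab) && turns t k then
    (pF (shape t k).2.+2 * phi (up t k) + pF (shape t k).2 * phi (dn t k))
      / pF (shape t k).2.+1
  else 0.

Lemma path_eE k phi t : t \in tab -> turns t k -> path_e k phi t =
  (pF (shape t k).2.+2 * phi (up t k) + pF (shape t k).2 * phi (dn t k))
      / pF (shape t k).2.+1.
Proof. by move=> tT tk; rewrite /path_e tT tk. Qed.

Lemma path_e0 k phi t : ~~ turns t k -> path_e k phi t = 0.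
Proof. by rewrite /path_e => /negPf->; rewrite andbF. Qed.

Lemma path_e_linear k : linear (path_e k).
Proof.
move=> c phi psi; apply/funext => t; rewrite /path_e !fctE /=.
case: ifP => _; last by rewrite [RHS]addr0 scaler0.
by rewrite -![_ *: _]/(_ * _); ring.
Qed.

Lemma path_e_off k phi s t : s \in tab -> t \in tab -> off k.+1 s t ->
  path_e k phi s = path_e k phi t.
Proof.
move=> sT tT st; rewrite /path_e sT tT (off_turns st).
case: ifP => //= tk; rewrite (off_up st) //.
have e : shape s k = shape t k by apply: st; apply/eqP; lia.
rewrite e; case: (posnP (shape t k).2) => [->|h0]; first by rewrite !mul0r.
by rewrite (off_dn st).
Qed.

Lemma path_e_local k phi psi t :
    (forall s, s \in tab -> off k.+1 s t -> phi s = psi s) ->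
  path_e k phi t = path_e k psi t.
Proof.
move=> e; rewrite /path_e; case: ifP => // /andP[tT tk].
rewrite e ?up_tab //; last exact: off_set.
case: (posnP (shape t k).2) => [->|h0]; first by rewrite !mul0r.
by rewrite (e (dn t k)) ?dn_tab //; apply: off_set.
Qed.

Lemma path_e_pick k phi t s : t \in tab -> turns t k -> s \in tab -> off k.+1 s t ->
    (forall s', s' \in tab -> off k.+1 s' t -> s' != s -> phi s' = 0) ->
  path_e k phi t = pF (shape s k.+1).2.+1 / pF (shape t k).2.+1 * phi s.
Proof.
move=> tT tk sT st phi0; rewrite path_eE //.
have sk : turns s k by rewrite (off_turns st).
have e : shape s k = shape t k by apply: st; apply/eqP; lia.
have ud : up t k != dn t k.
  by apply/eqP => /(congr1 (shape^~ k.+1)); rewrite !shape_set eqxx => -[]; lia.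
have [su|[h0 sd]] := up_or_dn sT sk.
  have {}su : s = up t k by rewrite su; apply: off_up.
  have -> : pF (shape t k).2 * phi (dn t k) = 0.
    case: (posnP (shape t k).2) => [->|h0]; first by rewrite mul0r.
    by rewrite phi0 ?mulr0 ?dn_tab // ?su 1?eq_sym //; apply: off_set.
  by rewrite su shape_set eqxx /= addr0; ring.
move: h0; rewrite e => h0.
have {}sd : s = dn t k by rewrite sd; apply: off_dn.
rewrite (phi0 (up t k)) ?up_tab ?sd //; last exact: off_set.
by rewrite mulr0 add0r shape_set eqxx /= prednK //; ring.
Qed.

Lemma path_e_sq k phi : path_e k (path_e k phi) = xF *: path_e k phi.
Proof.
apply/funext => t; rewrite fctE /= -[RHS]/(_ * _).
case tT : (t \in tab); last by rewrite /path_e tT mulr0.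
case tk : (turns t k); last by rewrite !path_e0 ?tk // mulr0.
rewrite path_eE // (path_e_off _ _ tT); [|exact: up_tab|exact: off_set].
have -> : pF (shape t k).2 * path_e k phi (dn t k) = pF (shape t k).2 * path_e k phi t.
  case: (posnP (shape t k).2) => [->|h0]; first by rewrite !mul0r.
  by rewrite (path_e_off _ _ tT); [|exact: dn_tab|exact: off_set].
(* Both neighbours carry the same value, so the eigenvalue is (p_(h+2) + p_h) / p_(h+1) = x. *)
by rewrite pFS -mulrDl subrK mulrAC mulfK // pF_neq0.
Qed.

(** Turning between k+1 and k+3 determines the shape at k+1 from the one at k+3, so at most one
    choice of the vertex k+1 achieves it; [turns_hi] supplies that choice. *)
Lemma turns_inj_hi k s t : s \in tab -> t \in tab -> off k.+1 s t ->
  turns s k.+1 -> turns t k.+1 -> s = t.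
Proof.
move=> sT tT st /eqP sk /eqP tk; apply: (tab_eq_off _ _ st) => //.
have : shape s k.+3 = shape t k.+3 by apply: st; apply/eqP; lia.
rewrite sk tk => -[]; case: (shape s _) => a b; case: (shape t _) => a' b' /=.
by move=> -> ->.
Qed.

Lemma turns_inj_lo k s t : s \in tab -> t \in tab -> off k.+2 s t ->
  turns s k -> turns t k -> s = t.
Proof.
move=> sT tT st /eqP sk /eqP tk; apply: (tab_eq_off _ _ st) => //.
by rewrite sk tk st //; apply/eqP; lia.
Qed.

Lemma turns_hi k t : t \in tab -> turns t k -> (k.+2 < n)%N ->
  exists s, [/\ s \in tab, off k.+1 s t & turns s k.+1].
Proof.
move=> tT tk kn; have /tableauP[_ _ _ ta] := tT.
have := ta _ kn; rewrite (eqP tk) => /arrowP[/= e|[/= e h0]].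
  exists (up t k); split; [exact: up_tab|exact: off_set|].
  by rewrite /turns !shape_set eqxx gtn_eqF // e.
exists (dn t k); split; [exact: dn_tab|exact: off_set|].
by rewrite /turns !shape_set eqxx gtn_eqF // e.
Qed.

Lemma turns_lo k t : t \in tab -> turns t k.+1 ->
  exists s, [/\ s \in tab, off k.+2 s t & turns s k].
Proof.
move=> tT tk; have /tableauP[_ _ _ ta] := tT.
have kn := turns_lt tT tk; have kk : (k < k.+2)%N by lia.
case/arrowP: (ta k (ltnW (ltnW kn))) => [e|[e h0]].
  have h0 : (0 < (shape t k.+1).2)%N by rewrite e.
  exists (dn t k.+1); split; [exact: dn_tab|exact: off_set|].
  by rewrite /turns !shape_set eqxx ltn_eqF // e.
exists (up t k.+1); split; [exact: up_tab|exact: off_set|].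
by rewrite /turns !shape_set eqxx ltn_eqF // e /= prednK.
Qed.

Lemma path_e_braid_up k phi : (k.+2 < n)%N ->
  path_e k (path_e k.+1 (path_e k phi)) = path_e k phi.
Proof.
move=> kn; apply/funext => t.
case tT : (t \in tab); last by rewrite /path_e tT.
case tk : (turns t k); last by rewrite !path_e0 ?tk.
have [s [sT st sk1]] := turns_hi tT tk kn.
have sk : turns s k by rewrite (off_turns st).
rewrite (path_e_pick tT tk sT st); last first.
  move=> s' s'T s't /eqP ss'; apply: path_e0; apply/negP => s'k.
  by case: ss'; apply: turns_inj_hi s'k sk1 => // j jk; rewrite s't ?st.
rewrite (path_e_pick sT sk1 sT) //; last first.
  move=> s' s'T s't /eqP ss'; apply: path_e0; apply/negP => s'k.
  by case: ss'; apply: turns_inj_lo s'k sk.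
rewrite (path_e_off _ sT tT st) (st k.+2); last by apply/eqP; lia.
(* With h' the height of s at k+1, the two weights are p_(h'+1) / p_(h+1) and p_(h+1) / p_(h'+1). *)
rewrite (eqP tk) /= mulrA mulf_div [X in X / _]mulrC.
by rewrite divff ?mul1r // mulf_neq0 ?pF_neq0.
Qed.

Lemma path_e_braid_dn k phi :
  path_e k.+1 (path_e k (path_e k.+1 phi)) = path_e k.+1 phi.
Proof.
apply/funext => t.
case tT : (t \in tab); last by rewrite /path_e tT.
case tk : (turns t k.+1); last by rewrite !path_e0 ?tk.
have [s [sT st sk]] := turns_lo tT tk.
have sk1 : turns s k.+1 by rewrite (off_turns st).
rewrite (path_e_pick tT tk sT st); last first.
  move=> s' s'T s't /eqP ss'; apply: path_e0; apply/negP => s'k.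
  by case: ss'; apply: turns_inj_lo s'k sk => // j jk; rewrite s't ?st.
rewrite (path_e_pick sT sk sT) //; last first.
  move=> s' s'T s't /eqP ss'; apply: path_e0; apply/negP => s'k.
  by case: ss'; apply: turns_inj_hi s'k sk1.
rewrite (path_e_off _ sT tT st) (st k.+1); last by apply/eqP; lia.
rewrite (eqP sk) /= mulrA mulf_div [X in X / _]mulrC.
by rewrite divff ?mul1r // mulf_neq0 ?pF_neq0.
Qed.

Lemma off_turns_far k k' s t : (k.+2 <= k')%N || (k'.+2 <= k)%N ->
  off k.+1 s t -> turns s k' = turns t k'.
Proof. by move=> kk st; rewrite /turns !st //; apply/eqP; lia. Qed.

(** Written over the four corners, the product is symmetric in k and k' up to the order of two
    independent changes of the path. *)
Lemma path_e_far k k' phi t :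
    (k.+2 <= k')%N || (k'.+2 <= k)%N -> t \in tab -> turns t k -> turns t k' ->
  path_e k (path_e k' phi) t =
  (pF (shape t k).2.+2 * (pF (shape t k').2.+2 * phi (up (up t k) k')
                          + pF (shape t k').2 * phi (dn (up t k) k'))
   + pF (shape t k).2 * (pF (shape t k').2.+2 * phi (up (dn t k) k')
                          + pF (shape t k').2 * phi (dn (dn t k) k')))
  / pF (shape t k').2.+1 / pF (shape t k).2.+1.
Proof.
move=> kk tT tk tk'.
have sk' y : shape (set_shape t k.+1 y) k' = shape t k'.
  by rewrite off_set //; apply/eqP; lia.
have sku : shape (up t k) k' = shape t k' := sk' _.
have skd : shape (dn t k) k' = shape t k' := sk' _.
have tk'' y : turns (set_shape t k.+1 y) k'.
  by rewrite (off_turns_far kk (off_set _ _)).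
rewrite path_eE // (path_eE _ (up_tab tT tk) (tk'' _)) sku; congr (_ / _).
rewrite [RHS]mulrDl -!mulrA; congr (_ + _).
case: (posnP (shape t k).2) => [->|h0]; first by rewrite !mul0r.
by rewrite (path_eE _ (dn_tab tT tk h0) (tk'' _)) skd.
Qed.

Lemma set_shapeC t k k' y z : k != k' ->
  set_shape (set_shape t k y) k' z = set_shape (set_shape t k' z) k y.
Proof. by move=> /negPf kk; rewrite /set_shape set_set_nth kk. Qed.

Lemma path_e_comm k k' phi : (k.+2 <= k')%N ->
  path_e k (path_e k' phi) = path_e k' (path_e k phi).
Proof.
move=> kk; apply/funext => t.
case tT : (t \in tab); last by rewrite /path_e tT.
have far0 j j' psi : (j.+2 <= j')%N || (j'.+2 <= j)%N -> ~~ turns t j ->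
    path_e j' (path_e j psi) t = 0.
  move=> jj tj; rewrite (@path_e_local _ _ (fun=> 0)) => [|s sT st].
    by rewrite /path_e !mulr0 addr0 mul0r; case: ifP.
  by apply: path_e0; rewrite (off_turns_far _ st) // orbC.
case tk : (turns t k); last by rewrite path_e0 ?far0 ?tk ?kk.
case tk' : (turns t k'); last first.
  by rewrite [RHS]path_e0 ?far0 ?tk' ?kk ?orbT.
rewrite !path_e_far ?kk ?orbT //.
have kk' : k'.+1 != k.+1 by apply/eqP; lia.
have e y : shape (set_shape t k.+1 y) k' = shape t k'.
  by rewrite off_set //; apply/eqP; lia.
have e' y : shape (set_shape t k'.+1 y) k = shape t k.
  by rewrite off_set //; apply/eqP; lia.
by rewrite /up /dn !e !e' !(set_shapeC _ _ _ kk'); ring.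
Qed.

End PathModule.

(** * The Jucys-Murphy elements on paths *)

(* The scalar by which [z_elt k] acts on the paths of shape [l] at [k]. *)
Definition zeta (l : nat * nat) : Fx := pF l.1 * pF (l.1 + l.2).+1.

(** The first product is zeta (i+1, h-1) in a form that makes sense at h = 0. So the two
    continuations of a path at (i, h) have values of [zeta] differing by the nonzero p_(h+1). *)
Lemma zeta_diff (i h : nat) :
  pF i.+1 * pF (i + h).+1 - zeta (i, h.+1) = pF h.+1.
Proof. by rewrite /zeta /= addnS (addnC i) pF_det addrC addKr. Qed.

(** On eigenvalues this is T_k = z_k - x z_(k-1); it merges the two cases of r_t(k) into one
    formula. *)
Lemma r_tabE n l t k : t \in tableaux n l -> (k < n)%N ->
  r_tab t k.+1 = zeta (shape t k.+1) - xF * zeta (shape t k).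
Proof.
move=> tT kn; have /tableauP[_ t0 _ ta] := tT.
have pk := tableau_part tT (ltnW kn).
rewrite /r_tab /zeta; case: k => [|k] in kn pk *.
  have := ta 0 kn; rewrite t0 => /arrowP[-> | [_]] //=.
  by rewrite !mul0r mulr0 subr0.
case/arrowP: (ta _ kn) pk => [->|[-> h0]]; rewrite /is_part /=.
  rewrite eqxx => /eqP pk.
  have -> : (k.+2 - (shape t k.+1).1 + 1)%N =
      ((shape t k.+1).1 + (shape t k.+1).2).+2 by lia.
  have -> : (k.+2 - (shape t k.+1).1)%N =
      ((shape t k.+1).1 + (shape t k.+1).2).+1 by lia.
  by rewrite addnS; ring.
move=> /eqP pk; rewrite ltn_eqF //.
have -> : (k.+2 - (shape t k.+1).1.+1 + 1)%N =
    ((shape t k.+1).1 + (shape t k.+1).2).+1 by lia.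
have -> : ((shape t k.+1).1.+1 + (shape t k.+1).2.-1)%N =
    ((shape t k.+1).1 + (shape t k.+1).2)%N by lia.
by ring.
Qed.

(** The recursion for T_(i+1) at the upper path of a turn, as a scalar identity: a, b, q are
    p_(h+2), p_h, p_(h+1); u, v are the values at the upper and lower path and ru, rd the
    eigenvalues of T_i there; rs is its eigenvalue on the path selected by e_(i-1); c is the value
    after e_i; z, z' belong to z_(i-1), z_(i-2). *)
Lemma diag_up (F : fieldType) (a b q ru rd rs z' z u v c r : F) :
    q != 0 -> rd - ru = q -> rs - z' = ru + rd -> c = (a * u + b * v) / q ->
    r = a - z ->
  - (ru * c) - (a * (ru * u) + b * (rd * v)) / q + rs * c - z * u - z' * c = r * u.
Proof.
move=> q0 qE sE -> ->.
have -> : rs = ru + rd + z' by rewrite -sE subrK.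
have -> : rd = q + ru by rewrite -qE subrK.
by field.
Qed.

Lemma diag_dn (F : fieldType) (a b q ru rd rs z' z u v c r : F) :
    q != 0 -> rd - ru = q -> rs - z' = ru + rd -> c = (a * u + b * v) / q ->
    r = - b - z ->
  - (rd * c) - (a * (ru * u) + b * (rd * v)) / q + rs * c - z * v - z' * c = r * v.
Proof.
move=> q0 qE sE -> ->.
have -> : rs = ru + rd + z' by rewrite -sE subrK.
have -> : rd = q + ru by rewrite -qE subrK.
by field.
Qed.

Section PathAction.
Variables (n : nat) (l : nat * nat).
Local Notation tab := (tableaux n l).
Local Notation V := (seq (nat * nat) -> Fx^o).
Implicit Types (t s : seq (nat * nat)) (phi psi : V).

Definition path_gen (i : tl_index n) : V -> V := path_e n l (val i).-1.

Lemma path_gen_linear i : linear (path_gen i). Proof. exact: path_e_linear. Qed.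

Lemma path_gen_sq i phi : path_gen i (path_gen i phi) = xF *: path_gen i phi.
Proof. exact: path_e_sq. Qed.

Lemma path_gen_braid (i j : tl_index n) phi :
  (val j == (val i).+1) || (val i == (val j).+1) ->
  path_gen i (path_gen j (path_gen i phi)) = path_gen i phi.
Proof.
case: i j => [[|i] /= i0] [[|j] /= j0] //; rewrite /path_gen /= !eqSS.
by case/orP => /eqP e; subst; [exact: path_e_braid_up|exact: path_e_braid_dn].
Qed.

Lemma path_gen_comm (i j : tl_index n) phi : ((val i).+2 <= val j)%N ->
  path_gen i (path_gen j phi) = path_gen j (path_gen i phi).
Proof.
case: i j => [[|i] /= i0] [[|j] /= j0] //; rewrite /path_gen /= => ij.
exact: path_e_comm.
Qed.

Definition pact (a : TL xF n) : V -> V := tl_act path_gen a.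

Lemma pact_linear a : linear (pact a).
Proof. exact: (tl_act_linear path_gen_linear). Qed.

Lemma pactM a b phi : pact (a * b) phi = pact b (pact a phi).
Proof.
exact: (tl_actM path_gen_linear path_gen_sq path_gen_braid path_gen_comm).
Qed.

Lemma pactD a b phi : pact (a + b) phi = pact a phi + pact b phi.
Proof.
exact: (tl_actD path_gen_linear path_gen_sq path_gen_braid path_gen_comm).
Qed.

Lemma pact_scal k phi : pact k%:A phi = k *: phi.
Proof.
exact: (tl_act_scal path_gen_linear path_gen_sq path_gen_braid path_gen_comm).
Qed.

Lemma pactZ k a phi : pact (k *: a) phi = k *: pact a phi.
Proof.
exact: (tl_actZ path_gen_linear path_gen_sq path_gen_braid path_gen_comm).
Qed.

Lemma pact1 phi : pact 1 phi = phi.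
Proof.
exact: (tl_act1 path_gen_linear path_gen_sq path_gen_braid path_gen_comm).
Qed.

Lemma pact0 phi : pact 0 phi = 0.
Proof. by rewrite -(scale0r 0) pactZ scale0r. Qed.

Lemma pactN a phi : pact (- a) phi = - pact a phi.
Proof. by rewrite -!scaleN1r pactZ. Qed.

Lemma pact_sum (I : Type) (r : seq I) (P : pred I) F phi :
  pact (\sum_(i <- r | P i) F i) phi = \sum_(i <- r | P i) pact (F i) phi.
Proof.
by elim/big_rec2: _ => [|i a b _ <-]; rewrite ?pact0 ?pactD.
Qed.

Lemma pact_e k phi : (k.+1 < n)%N -> pact (tl_e xF n k.+1) phi = path_e n l k phi.
Proof.
move=> kn; rewrite /tl_e insubT.
exact: (tl_act_gen path_gen_linear path_gen_sq path_gen_braid path_gen_comm).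
Qed.

(** Elements of A_k change only vertices before k, so the value at t involves only paths with the
    same tail as t. *)
Lemma pact_local k a phi psi t : (k <= n)%N -> t \in tab ->
    subalg (itv 1 k) a ->
    (forall s, s \in tab -> (forall j, (k <= j)%N -> shape s j = shape t j) ->
      phi s = psi s) ->
  pact a phi t = pact a psi t.
Proof.
move=> kn tT ka; elim: ka phi psi t tT =>
    [c|[|i] // ik|b c _ IHb _ IHc|b c _ IHb _ IHc] phi psi t tT e.
- by rewrite !pact_scal !fctE /= e.
- have kk : (i.+1 < k)%N by move: ik; rewrite /itv; lia.
  rewrite !pact_e; try lia.
  apply: path_e_local => s sT st; apply: e => // j kj; apply: st.
  by apply/eqP; lia.
- by rewrite !pactD !fctE (IHb _ psi) // (IHc _ psi).
- rewrite !pactM; apply: IHc => // s sT st; apply: IHb => // s' s'T s't.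
  by apply: e => // j kj; rewrite s't ?st.
Qed.

Lemma pact_eq_on_tab a phi psi : {in tab, phi =1 psi} ->
  {in tab, pact a phi =1 pact a psi}.
Proof.
move=> e t tT; apply: (@pact_local n) => // [|s sT _]; last exact: e.
by apply: subalgW (subalg_full a) => i; rewrite /itv.
Qed.

Lemma set_shape_id t k y : t \in tab -> (k <= n)%N -> shape t k = y ->
  set_shape t k y = t.
Proof.
move=> /tableauP[st _ _ _] kn <-; apply: (@eq_from_nth _ (0, 0)%N).
  by rewrite size_set_nth st; lia.
by move=> j _; rewrite -!/(shape _ _) shape_set; case: eqP => [->|].
Qed.

Definition rho t k : Fx := zeta (shape t k) - xF * zeta (shape t k.-1).

Lemma z_eltS k : z_elt xF n k.+1 = T_elt xF n k.+1 + xF *: z_elt xF n k.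
Proof.
(* The convention z_0 = z_1 = 0 agrees with the sum because T_0 = T_1 = 0. *)
have zE j : z_elt xF n j = \sum_(i < j.+1) xF ^+ i *: T_elt xF n (j - i).
  rewrite /z_elt; case: j => [|[|j]] //=.
    by rewrite big_ord1 T_elt0 scaler0.
  by rewrite !big_ord_recl big_ord0 /= T_elt1 T_elt0 !scaler0 !addr0.
rewrite !zE big_ord_recl expr0 scale1r subn0; congr (_ + _).
rewrite scaler_sumr; apply: eq_bigr => i _.
by rewrite scalerA -exprS.
Qed.

Lemma z_diag k phi t : t \in tab ->
    (forall j, (j <= k)%N -> pact (T_elt xF n j) phi t = rho t j * phi t) ->
  pact (z_elt xF n k) phi t = zeta (shape t k) * phi t.
Proof.
move=> tT; elim: k => [|k IHk] Tk.
  have /tableauP[_ -> _ _] := tT.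
  by rewrite pact0 /zeta !mul0r.
rewrite z_eltS pactD pactZ !fctE IHk => [|j jk]; last by apply: Tk; lia.
by rewrite Tk // /rho /= -[_ *: _]/(_ * _); ring.
Qed.

(* With [k = m + 2], the operators [e_k] and [e_(k-1)] act as [path_e m.+1] and
   [path_e m]. *)
Lemma T_diag_step m phi t : (m.+2 < n)%N -> t \in tab ->
    (forall j psi s, (j <= m.+2)%N -> s \in tab ->
      pact (T_elt xF n j) psi s = rho s j * psi s) ->
  pact (T_elt xF n m.+3) phi t = rho t m.+3 * phi t.
Proof.
move=> mn tT Tdiag.
have zdiag j psi s : (j <= m.+2)%N -> s \in tab ->
    pact (z_elt xF n j) psi s = zeta (shape s j) * psi s.
  by move=> jm sT; apply: z_diag => // i ij; apply: Tdiag => //; apply: leq_trans jm.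
rewrite T_eltS // !(pactD, pactN) !pactM !pact_e; try lia.
set chi := path_e n l m.+1 phi.
rewrite !fctE /= Tdiag // !zdiag //; try lia.
have pk := tableau_part tT (ltnW (ltnW mn)).
have /tableauP[_ _ _ ta] := tT.
(* For two steps in the same direction all terms with e_k vanish; the remaining - z_(k-1) matches by
   the three-term recurrence. *)
case tk : (turns t m.+1); last first.
rewrite /chi !path_e0 ?tk // !mulr0 !subr0 oppr0 !add0r.
  have a1 := ta _ (ltnW mn); have a2 := ta _ mn.
  rewrite /rho /= -mulNr; congr (_ * _); rewrite /zeta.
  move: a1 a2 tk; rewrite /turns => /arrowP[->|[-> h1]] /= /arrowP[->|[-> h2]] /=.
  - by rewrite !addnS (pFS (_ + _).+1) => _; ring.
  - by rewrite eqxx.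
  - by rewrite prednK ?eqxx.
  - move=> _; set i := (shape t m.+1).1; set h := (shape t m.+1).2 in h1 h2 *.
    rewrite /= in h2.
    have -> : (i.+2 + h.-2 = i + h)%N by lia.
    have -> : (i.+1 + h.-1 = i + h)%N by lia.
    by rewrite pFS; ring.
have [s [sT st sk]] := turns_lo tT tk.
have sk1 : turns s m.+1 by rewrite (off_turns st).
have sm : shape s m = shape t m by apply: st; apply/eqP; lia.
have sm1 : shape s m.+1 = shape t m.+1 by apply: st; apply/eqP; lia.
(* Only the path s turning at both m and m+1 contributes, so T_k enters through one eigenvalue and
   the weights cancel as in the braid relation. *)
have -> : path_e n l m.+1 (pact (T_elt xF n m.+2) (path_e n l m chi)) t =
    rho s m.+2 * chi t.
  rewrite (path_e_pick tT tk sT st); last first.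
    move=> s' s'T s't /eqP ss'; rewrite Tdiag // path_e0 ?mulr0 //.
    apply/negP => s'k; case: ss'; apply: (turns_inj_lo s'T sT _ s'k sk) => // j jk.
    by rewrite s't ?st.
  rewrite Tdiag // (path_e_pick sT sk sT) //; last first.
    move=> s' s'T s't /eqP ss'; apply: path_e0; apply/negP => s'k.
    by case: ss'; apply: (turns_inj_hi s'T sT _ s'k sk1).
  rewrite /chi (path_e_off _ sT tT st) sm1 (eqP sk) /= mulrCA; congr (_ * _).
  rewrite mulrA mulf_div [X in X / _]mulrC.
  by rewrite divff ?mul1r // mulf_neq0 ?pF_neq0.
(* The condition rs - z' = ru + rd of [diag_up], with [zeta] of the lower path as a product, so that
   it also holds when that path does not exist. *)
have sr : rho s m.+2 - zeta (shape t m) =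
    zeta ((shape t m.+1).1, (shape t m.+1).2.+1) +
    pF (shape t m.+1).1.+1 * pF ((shape t m.+1).1 + (shape t m.+1).2).+1 -
    2%:R * xF * zeta (shape t m.+1).
  rewrite /rho /= (eqP sk) sm1 sm /zeta.
  case/arrowP: (ta _ (ltnW (ltnW mn))) => [->|[-> h0]] /=.
    by rewrite !addnS !addSn !pFS; ring.
  rewrite !addnS !addSn.
  have -> : ((shape t m).1 + (shape t m).2.-1).+1 =
      ((shape t m).1 + (shape t m).2)%N by lia.
  by rewrite !pFS; ring.
rewrite -/chi in sr *.
have ru : rho (up t m.+1) m.+2 =
    zeta ((shape t m.+1).1, (shape t m.+1).2.+1) - xF * zeta (shape t m.+1).
  by rewrite /rho /up !shape_set eqxx ltn_eqF.
have rd : rho (dn t m.+1) m.+2 =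
    zeta ((shape t m.+1).1.+1, (shape t m.+1).2.-1) - xF * zeta (shape t m.+1).
  by rewrite /rho /dn !shape_set eqxx ltn_eqF.
have chiE := path_eE phi tT tk; rewrite -/chi in chiE.
set i := (shape t m.+1).1 in ru rd sr chiE *.
set h := (shape t m.+1).2 in ru rd sr chiE *.
have tm1 : shape t m.+1 = (i, h) by rewrite /i /h; case: (shape t m.+1).
rewrite tm1 in ru rd sr *.
have rd' : (0 < h)%N -> rho (dn t m.+1) m.+2 =
    pF i.+1 * pF (i + h).+1 - xF * zeta (i, h).
  by move=> h0; rewrite rd /zeta /= addSn -addnS prednK.
have -> : path_e n l m.+1 (pact (T_elt xF n m.+2) phi) t =
    (pF h.+2 * (rho (up t m.+1) m.+2 * phi (up t m.+1)) +
     pF h * ((pF i.+1 * pF (i + h).+1 - xF * zeta (i, h)) * phi (dn t m.+1)))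
      / pF h.+1.
  rewrite path_eE // tm1 /= (Tdiag _ _ (up t m.+1)) ?up_tab //; congr ((_ + _) / _).
  have [->|h0] := posnP h; first by rewrite !mul0r.
  by rewrite Tdiag ?dn_tab ?tm1 // rd'.
have tm3 : shape t m.+3 = (i.+1, h) by rewrite (eqP tk) tm1.
have q0 := pF_neq0 h; have det := pF_det h i.
have ihC : (h + i = i + h)%N by rewrite addnC.
have [tu|[h0 td]] := up_or_dn tT tk.
  have pt : phi t = phi (up t m.+1) by rewrite -tu.
  have rt : rho t m.+2 = rho (up t m.+1) m.+2 by rewrite -tu.
  have tm2 : shape t m.+2 = (i, h.+1) by rewrite tu shape_set eqxx tm1.
  have r3 : rho t m.+3 = zeta (i.+1, h) - xF * zeta (i, h.+1) by rewrite /rho tm3 tm2.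
  rewrite pt rt r3; apply: diag_up q0 _ _ chiE _.
  - by rewrite ru -ihC det ihC /zeta /= addnS; ring.
  - by rewrite sr ru; ring.
  have := pF_det h.+1 i; rewrite /zeta /= !addnS !addSn ihC => ->.
  by rewrite (pFS (i + h).+1); ring.
have pt : phi t = phi (dn t m.+1) by rewrite -td.
have rt : rho t m.+2 = rho (dn t m.+1) m.+2 by rewrite -td.
have tm2 : shape t m.+2 = (i.+1, h.-1) by rewrite td shape_set eqxx tm1.
have r3 : rho t m.+3 = zeta (i.+1, h) - xF * zeta (i.+1, h.-1) by rewrite /rho tm3 tm2.
move: h0; rewrite tm1 /= => h0.
rewrite pt rt r3 rd' //; apply: diag_dn q0 _ _ chiE _.
- by rewrite ru -ihC det ihC /zeta /= addnS; ring.
- by rewrite sr ru; ring.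
have := pF_det h.-1 i; rewrite /zeta /= !addSn.
have -> : (h.-1 + i).+1 = (i + h)%N by lia.
have -> : (i + h.-1).+1 = (i + h)%N by lia.
rewrite prednK // (pFS (i + h)) => E.
have -> : - pF h - pF i * pF (i + h).+1 = - (pF i.+1 * pF (i + h)) by rewrite E; ring.
by ring.
Qed.

Lemma T_diag k phi t : (k <= n)%N -> t \in tab ->
  pact (T_elt xF n k) phi t = rho t k * phi t.
Proof.
elim/ltn_ind: k phi t => -[|[|[|k]]] IH phi t kn tT.
- have /tableauP[_ t0 _ _] := tT.
  by rewrite T_elt0 pact0 /rho /= t0 /zeta !mul0r mulr0 subr0 mul0r.
- have /tableauP[_ t0 _ /(_ 0%N kn)] := tT; rewrite t0 => /arrowP[t1|[_]] //.
  by rewrite T_elt1 pact0 /rho /= t0 t1 /zeta !mul0r mulr0 subr0 mul0r.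
- rewrite T_elt2 pact_e //.
  have /tableauP[_ t0 _ ta] := tT.
  have := ta 0 (ltnW kn); rewrite t0 => /arrowP[t1|[_]] //=.
  rewrite /rho /= t1.
  have [tk|tk] := boolP (turns t 0).
    rewrite path_eE // t0 /= mul0r addr0 divr1.
    have -> : up t 0 = t.
      by rewrite /up t0; apply: set_shape_id; rewrite ?t1 // ltnW.
    by rewrite (eqP tk) t0 /zeta /= mul0r mulr0 subr0 mul1r.
  rewrite path_e0 //; move: tk; rewrite /turns t0 /=.
  have := ta 1 kn; rewrite t1 => /arrowP[->|[-> _]] //= _.
  by rewrite /zeta !mul0r mulr0 subr0 mul0r.
- by apply: T_diag_step => // j psi s jk sT; apply: IH => //; lia.
Qed.

End PathAction.

(** * Joint eigenvalues separate the paths *)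

Section Separation.
Variables (n : nat) (l : nat * nat).
Local Notation tab := (tableaux n l).
Implicit Types (t u : seq (nat * nat)).

Lemma take_tableau t k : t \in tab -> (k <= n)%N ->
  take k.+1 t \in tableaux k (shape t k).
Proof.
move=> /tableauP[st t0 tn ta] kn.
have sh j : (j <= k)%N -> shape (take k.+1 t) j = shape t j.
  by move=> jk; rewrite /shape nth_take.
apply/tableauP; split; rewrite ?sh //.
  by rewrite size_takel // st.
by move=> j jk; rewrite !sh ?ta //; lia.
Qed.

Lemma r_tab_in_r_set t k : t \in tab -> (0 < k <= n)%N -> r_tab t k \in r_set k.
Proof.
move=> tT /andP[k0 kn]; rewrite mem_undup; apply/allpairsPdep.
exists (shape t k), (take k.+1 t); split; first 2 last.
- by rewrite /r_tab /shape !nth_take //; case: (k) k0.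
- by rewrite mem_parts; exact: (tableau_part tT kn).
- exact: take_tableau.
Qed.

(** Where two paths first differ they leave a common shape in the two possible ways, and [zeta_diff]
    separates the eigenvalues. The first step is forced, which is why k starts at 2. *)
Lemma r_tab_inj t u : t \in tab -> u \in tab ->
  (forall k, (2 <= k <= n)%N -> r_tab t k = r_tab u k) -> t = u.
Proof.
move=> tT uT e; apply: (tab_eq tT uT).
have /tableauP[_ t0 _ ta] := tT; have /tableauP[_ u0 _ ua] := uT.
elim=> [|k IHk] kn; first by rewrite t0 u0.
have tu := IHk (ltnW kn).
have neq i h : zeta (i, h.+1) - xF * zeta (shape u k)
    != pF i.+1 * pF (i + h).+1 - xF * zeta (shape u k).
  rewrite (inj_eq (addIr _)) eq_sym -subr_eq0 zeta_diff.
  exact: pF_neq0.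
have zdn i h : (0 < h)%N -> zeta (i.+1, h.-1) = pF i.+1 * pF (i + h).+1.
  by move=> h0; rewrite /zeta /= addSn -addnS prednK.
case: k => [|k] in kn IHk tu neq *.
  move: (ta 0 kn) (ua 0 kn); rewrite t0 u0.
  by move=> /arrowP[->|[_]] // /arrowP[->|[_]].
have := e k.+2 kn; rewrite !(r_tabE (n := n) (l := l)) // tu.
have h0 : arrow (shape u k.+1) (shape t k.+2) by rewrite -tu ta.
case/arrowP: h0 => [->|[-> h0]]; case/arrowP: (ua _ kn) => [->|[-> h1]] // /eqP.
  by rewrite zdn // (negPf (neq _ _)).
by rewrite zdn // eq_sym (negPf (neq _ _)).
Qed.

Lemma pact_prod_diag (I : eqType) (s : seq I) (P : pred I) (F : I -> TL xF n)
    (c : I -> seq (nat * nat) -> Fx) phi u : u \in tab ->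
    (forall i psi, i \in s -> P i -> pact l (F i) psi u = c i u * psi u) ->
  pact l (\prod_(i <- s | P i) F i) phi u = (\prod_(i <- s | P i) c i u) * phi u.
Proof.
move=> uT; elim: s phi => [|i s IHs] phi Fc.
  by rewrite !big_nil pact1 mul1r.
have {}IHs psi : pact l (\prod_(j <- s | P j) F j) psi u =
    \prod_(j <- s | P j) c j u * psi u.
  by apply: IHs => j psi' js; apply: Fc; rewrite inE js orbT.
rewrite !big_cons; case: ifP => // Pi; rewrite pactM IHs Fc ?mem_head //.
by rewrite mulrCA mulrA.
Qed.

Lemma F_proj t phi u : t \in tab -> u \in tab ->
  pact l (F_elt n t) phi u = (u == t)%:R * phi u.
Proof.
move=> tT uT; pose c k r u := (r_tab t k - r)^-1 * (r_tab u k - r).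
have factor k r psi : (2 <= k <= n)%N ->
    pact l ((r_tab t k - r)^-1 *: (T_elt xF n k - r%:A)) psi u = c k r u * psi u.
  move=> /andP[k2 kn]; rewrite pactZ pactD pactN pact_scal !fctE T_diag //.
  have: rho u k = r_tab u k.
    by case: k k2 kn => // k _ kn; rewrite (r_tabE uT).
  move=> ->; rewrite -[LHS]/((r_tab t k - r)^-1 * (r_tab u k * psi u - r * psi u)).
  by rewrite -mulrBl mulrA.
rewrite /F_elt (pact_prod_diag (c := fun k u =>
    \prod_(r <- r_set k | r != r_tab t k) c k r u)) //; last first.
  move=> k psi; rewrite mem_index_iota ltnS => kn _.
  by apply: pact_prod_diag => // r psi' _ _; apply: factor.
congr (_ * _); have [->|ut] := eqVneq u t.
  rewrite big1 // => k _; rewrite big1 // => r rt.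
  by rewrite /c mulVf // subr_eq0 eq_sym.
(* The eigenvalue of u at such a k lies in R(k) and differs from that of t, so it provides a
   vanishing factor. *)
have [k kn rk] : exists2 k, (2 <= k <= n)%N & r_tab u k != r_tab t k.
  apply: contrapT => nk; case/eqP: ut; apply: r_tab_inj => // k kn.
  by apply/eqP; apply: contrapT => /negP rk; apply: nk; exists k.
rewrite (bigD1_seq k) ?iota_uniq ?mem_index_iota //=.
apply/eqP; rewrite mulf_eq0 prodf_seq_eq0; apply/orP; left; apply/hasP.
exists (r_tab u k); first by apply: r_tab_in_r_set => //; lia.
by rewrite rk /c subrr mulr0 eqxx.
Qed.

End Separation.

(** * The action of m_lambda on paths *)

Section Arcs.
Variables (n : nat) (l : nat * nat).
Local Notation tab := (tableaux n l).
Implicit Types (t u : seq (nat * nat)).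

Lemma arcs_mono t j k : t \in tab -> (j <= k <= n)%N ->
  ((shape t j).1 <= (shape t k).1)%N.
Proof.
move=> /tableauP[_ _ _ ta] /andP[jk kn]; rewrite -(subnKC jk).
have: (j + (k - j) <= n)%N by lia.
elim: (k - j)%N => [|m IHm] mn; first by rewrite addn0.
move: mn; rewrite addnS => mn; apply: leq_trans (IHm (ltnW mn)) _.
by case/arrowP: (ta _ mn) => [->|[-> _]] /=; lia.
Qed.

Definition returns t f := all (fun j => (shape t (2 * j)).2 == 0%N) (iota 0 f.+1).

Lemma returnsS t f : returns t f.+1 = returns t f && ((shape t (2 * f.+1)).2 == 0%N).
Proof.
have e : iota 0 f.+2 = iota 0 f.+1 ++ [:: f.+1] by rewrite -(addn1 f.+1) iotaD.
by rewrite /returns e all_cat [X in _ && X]/= andbT.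
Qed.

Lemma returns_last t f : returns t f -> (shape t (2 * f)).2 = 0%N.
Proof. by move/allP => /(_ f); rewrite mem_iota ltnSn => /(_ isT)/eqP. Qed.

Lemma returns_shape t f j : t \in tab -> (2 * f <= n)%N -> returns t f ->
  (j <= f)%N -> shape t (2 * j) = (j, 0%N).
Proof.
move=> tT fn /allP tf jf.
have /eqP h0 : (shape t (2 * j)).2 == 0%N by apply: tf; rewrite mem_iota.
have := @tableau_part _ _ _ (2 * j) tT; rewrite /is_part h0.
by case: (shape t _) h0 => a b /= -> P; congr pair; lia.
Qed.

(** At height 0 the generator e_(2j+1) has the single weight p_2 / p_1 = x; paths at positive height
    after 2j steps are already killed by the earlier factors. *)
Lemma pact_arcs f phi t : (2 * f <= n)%N -> t \in tab ->
  pact l (arcs xF n f) phi t = (returns t f)%:R * xF ^+ f * phi t.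
Proof.
elim: f phi t => [|f IHf] phi t fn tT.
  have /tableauP[_ t0 _ _] := tT.
  by rewrite arcs0 pact1 /returns /= muln0 t0 !mul1r.
have fn' : (2 * f <= n)%N by lia.
rewrite arcsS pactM pact_e; last lia.
case tf : (returns t f.+1); last first.
  rewrite !mul0r.
  case tk : (turns t (2 * f)); last by rewrite path_e0 ?tk.
  have [h0|h0] := posnP (shape t (2 * f)).2.
    have tu : t = up t (2 * f) by case: (up_or_dn tT tk) => // -[]; rewrite h0.
    rewrite path_eE // h0 mul0r addr0 -tu IHf //.
    move: tf; rewrite returnsS mulnS (eqP tk) /= h0 andbT => ->.
    by rewrite !mul0r mulr0 mul0r.
  rewrite path_eE // IHf ?up_tab // IHf ?dn_tab //.
  have nr y : returns (set_shape t (2 * f).+1 y) f = false.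
    apply/negP => /returns_last; rewrite off_set //; last by apply/eqP; lia.
    by move=> e; rewrite e in h0.
  by rewrite /up /dn !nr !(mul0r, mulr0) addr0 mul0r.
have tf' : returns t f by move: tf; rewrite returnsS => /andP[].
have s1 := returns_shape tT fn' tf' (leqnn f).
have s2 := returns_shape tT fn tf (leqnn f.+1).
have tk : turns t (2 * f) by rewrite /turns -addn2 -mulnSr s2 s1.
have tu : t = up t (2 * f) by case: (up_or_dn tT tk) => // -[]; rewrite s1.
rewrite path_eE // s1 /= mul0r addr0 -tu divr1 IHf // tf' !mul1r.
by rewrite exprS mulrA pFS mulr1 subr0.
Qed.

End Arcs.

(** * The invariant form *)

Section Form.
Variables (n : nat) (l : nat * nat).
Local Notation tab := (tableaux n l).
Local Notation V := (seq (nat * nat) -> Fx^o).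
Implicit Types (t s u : seq (nat * nat)) (phi psi : V).

Definition path_weight t : Fx := \prod_(0 <= k < n.+1) pF (shape t k).2.+1.

Definition path_form phi psi : Fx := \sum_(t <- tab) path_weight t * phi t * psi t.

Lemma path_form_bilinear : bilinear_for *%R *%R path_form.
Proof.
split=> [psi c phi phi'|phi c psi psi'] /=; rewrite /path_form mulr_sumr -big_split;
  apply: eq_bigr => t _ /=; rewrite !fctE -[_ *: _]/(_ * _) /=; ring.
Qed.

Definition offb k s t := set_shape s k (0, 0)%N == set_shape t k (0, 0)%N.

Lemma offP k s t : s \in tab -> t \in tab -> (k <= n)%N ->
  reflect (off k s t) (offb k s t).
Proof.
move=> /tableauP[ss _ _ _] /tableauP[st _ _ _] kn; apply: (iffP eqP) => [e j jk|e].
  by move/(congr1 (shape^~ j)): e; rewrite !shape_set (negPf jk).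
apply: (@eq_from_nth _ (0, 0)%N); first by rewrite !size_set_nth ss st.
move=> j _; rewrite -!/(shape _ _) !shape_set.
by case: eqP => // /eqP /e.
Qed.

Definition path_mx k t s : Fx :=
  if turns t k && offb k.+1 s t then pF (shape s k.+1).2.+1 / pF (shape t k).2.+1
  else 0.

Lemma path_e_sum k phi t : t \in tab -> (k.+1 < n)%N ->
  path_e n l k phi t = \sum_(s <- tab) path_mx k t s * phi s.
Proof.
move=> tT kn; case tk : (turns t k); last first.
  by rewrite path_e0 ?tk // big1 // => s _; rewrite /path_mx tk mul0r.
have uT := up_tab tT tk.
have ut : offb k.+1 (up t k) t by apply/offP => //; [lia|exact: off_set].
rewrite (bigD1_seq (up t k)) ?tableaux_uniq //= path_eE // mulrDl.
congr (_ + _); first by rewrite /path_mx tk ut shape_set eqxx /= mulrAC.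
have ud : up t k != dn t k.
  by apply/eqP => /(congr1 (shape^~ k.+1)); rewrite !shape_set eqxx => -[]; lia.
have only s : s \in tab -> s != up t k -> path_mx k t s != 0 ->
    (0 < (shape t k).2)%N /\ s = dn t k.
  move=> sT su; rewrite /path_mx tk /=; case: ifP => [|_]; last by rewrite eqxx.
  move=> /offP-/(_ sT tT (ltnW kn)) st _.
  have e : shape s k = shape t k by apply: st; apply/eqP; lia.
  have sk : turns s k by rewrite (off_turns st).
  have [sE|[h0 sE]] := up_or_dn sT sk.
    by case/eqP: su; rewrite sE; apply: (off_up st sT tT tk).
  by rewrite -e; split=> //; rewrite sE; apply: (off_dn st sT tT tk); rewrite -e.
have [h0|h0] := posnP (shape t k).2.
  rewrite h0 !mul0r big_seq_cond big1 // => s /andP[sT su].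
  have [->|/(only s sT su)[]] := eqVneq (path_mx k t s) 0; first by rewrite mul0r.
  by rewrite h0.
have dT := dn_tab tT tk h0.
have dt : offb k.+1 (dn t k) t by apply/offP => //; [lia|exact: off_set].
rewrite big_mkcond (bigD1_seq (dn t k)) ?tableaux_uniq //= eq_sym ud.
rewrite [path_mx _ _ (dn t k)]/path_mx tk dt /= shape_set eqxx /= prednK //.
rewrite big_seq_cond big1 ?addr0 => [|s /andP[sT sd]].
  by rewrite mulrAC.
case: ifP => // su.
have [->|/(only s sT su)[_ sE]] := eqVneq (path_mx k t s) 0; first by rewrite mul0r.
by rewrite sE eqxx in sd.
Qed.

(** The weights of s and t differ only in the factor at k+1, which is the numerator of the opposite
    matrix entry. This balance dictates [path_weight]. *)
Lemma path_mx_sym k s t : s \in tab -> t \in tab -> (k.+1 < n)%N ->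
  path_weight t * path_mx k t s = path_weight s * path_mx k s t.
Proof.
move=> sT tT kn; rewrite /path_mx.
have -> : offb k.+1 t s = offb k.+1 s t by rewrite /offb eq_sym.
case st: (offb k.+1 s t); last by rewrite !andbF !mulr0.
move/offP: st => /(_ sT tT (ltnW kn)) st.
rewrite (off_turns st); case: ifP => _; last by rewrite !mulr0.
rewrite (st k); last by apply/eqP; lia.
rewrite !mulrA; congr (_ / _); rewrite /path_weight.
rewrite !(bigD1_seq k.+1) ?mem_index_iota ?iota_uniq //=; try lia.
rewrite mulrAC [X in _ = X]mulrAC [X in X * _ = _]mulrC; congr (_ * _).
by apply: eq_bigr => j jk; rewrite st.
Qed.

Lemma path_gen_adjoint (i : tl_index n) phi psi :
  path_form (path_gen l i phi) psi = path_form phi (path_gen l i psi).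
Proof.
case: i => [[|k] //= kn]; rewrite /path_gen /path_form /=.
transitivity (\sum_(t <- tab) \sum_(s <- tab)
    path_weight t * path_mx k t s * phi s * psi t).
  apply: eq_big_seq => t tT; rewrite path_e_sum // mulr_sumr mulr_suml.
  by apply: eq_bigr => s _; rewrite !mulrA.
rewrite exchange_big; apply: eq_big_seq => s sT /=.
rewrite path_e_sum // mulr_sumr; apply: eq_big_seq => t tT /=.
by rewrite path_mx_sym //; ring.
Qed.

Lemma path_form_star (a : TL xF n) phi psi :
  path_form (pact l a phi) psi = path_form phi (pact l (tl_star a) psi).
Proof.
exact: (tl_act_star (@path_gen_linear n l) (@path_gen_sq n l)
  (@path_gen_braid n l) (@path_gen_comm n l) path_form_bilinear
  path_gen_adjoint).
Qed.

End Form.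

(** * The path selected by m_lambda *)

Section BasePath.
Variables (n : nat) (l : nat * nat).
Local Notation tab := (tableaux n l).
Local Notation V := (seq (nat * nat) -> Fx^o).
Implicit Types (t s u : seq (nat * nat)) (phi psi : V).

Definition delta s : V := fun u => (u == s)%:R.

Definition base f m : nat * nat :=
  if (m <= 2 * f)%N then (m./2, nat_of_bool (odd m)) else (f, m - 2 * f)%N.

Lemma base_hi f m : (2 * f <= m)%N -> base f m = (f, m - 2 * f)%N.
Proof.
rewrite /base leq_eqVlt => /predU1P[<-|fm]; last by rewrite leqNgt fm.
by rewrite leqnn subnn mul2n doubleK odd_double.
Qed.

Lemma base_lo f m : (m <= (2 * f).+1)%N -> base f.+1 m = base f m.
Proof.
rewrite leq_eqVlt ltnS => /predU1P[->|mf].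
  rewrite [RHS]base_hi // subSnn /base mulnS ltnS leqnSn mul2n /=.
  by rewrite uphalf_double odd_double.
by rewrite /base mf; have -> : (m <= 2 * f.+1)%N by lia.
Qed.

Definition graft (F : nat -> nat * nat) := mkseq F n.+1.

Lemma shape_graft F m : (m <= n)%N -> shape (graft F) m = F m.
Proof. by move=> mn; rewrite /shape nth_mkseq. Qed.

Lemma eq_graft t F : t \in tab ->
  (forall m, (m <= n)%N -> shape t m = F m) -> t = graft F.
Proof.
move=> /tableauP[st _ _ _] e; apply: (@eq_from_nth _ (0, 0)%N).
  by rewrite size_mkseq.
by move=> m; rewrite st => mn; rewrite -!/(shape _ _) shape_graft ?e.
Qed.

Definition start := graft (base l.1).

Lemma start_tab : is_part n l -> start \in tab.
Proof.
rewrite /is_part => /eqP nl; apply/tableauP; split.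
- by rewrite size_mkseq.
- by rewrite shape_graft.
- by rewrite shape_graft // base_hi -?nl ?leq_addr // addKn; case: (l).
move=> k kn; rewrite !shape_graft //; last exact: ltnW.
have [lk|kl] := leqP (2 * l.1) k.
  by rewrite !base_hi //; [apply/arrowP; left; congr pair => /=; lia|lia].
rewrite /base (ltnW kl) kl /= uphalf_half; case: (odd k) => /=; rewrite ?add0n ?add1n.
  by apply/arrowP; right.
by apply/arrowP; left.
Qed.

Lemma returns_start t : is_part n l -> t \in tab -> returns t l.1 = (t == start).
Proof.
move=> nl tT; have nl' : (2 * l.1 <= n)%N by move: nl; rewrite /is_part; lia.
apply/idP/eqP => [tr|->]; last first.
  apply/allP => j; rewrite mem_iota => jl; rewrite shape_graft; last by lia.
  rewrite /base; have -> : (2 * j <= 2 * l.1)%N by lia.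
  by rewrite mul2n odd_double.
have rs := returns_shape tT nl' tr.
apply: eq_graft => // m mn; have /tableauP[_ _ tn ta] := tT.
have [lm|ml] := leqP (2 * l.1) m.
  (* At 2f all f down steps are spent; their number never decreases and ends at f, so only up steps
     remain. *)
  rewrite base_hi //; have p := tableau_part tT mn.
  have a1 := @arcs_mono _ _ _ (2 * l.1) m tT.
  have a2 := @arcs_mono _ _ _ m n tT.
  move: p a1 a2; rewrite /is_part rs // tn lm mn leqnn.
  by case: (shape t m) => a b /= p a1 a2; congr pair; lia.
rewrite /base (ltnW ml) -(odd_double_half m); set j := m./2.
have jl : (j < l.1)%N by rewrite /j; lia.
case: (odd m); last by rewrite add0n doubleK odd_double -mul2n rs // ltnW.
rewrite add1n /= uphalf_double odd_double /=.
have := ta (2 * j)%N; rewrite rs ?(ltnW jl) // -mul2n => /(_ _)/arrowP[|->|[_]] //.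
by lia.
Qed.

End BasePath.

(** * The coefficient of a tableau in its standard word *)

Section LeadingCoefficient.
Variables (n : nat) (l : nat * nat).
Local Notation tab := (tableaux n l).
Local Notation V := (seq (nat * nat) -> Fx^o).
Implicit Types (t s u : seq (nat * nat)) (phi psi : V).

(** The down step number f+1 is delayed until after vertex j; after vertex k the path follows t. *)
Definition slide f k t j := graft n (fun m =>
  if (m <= j)%N then base f m else if (m <= k)%N then base f.+1 m else shape t m).

Lemma shape_slide f k t j m : (m <= n)%N -> shape (slide f k t j) m =
  if (m <= j)%N then base f m else if (m <= k)%N then base f.+1 m else shape t m.
Proof. exact: shape_graft. Qed.

Lemma turns_slide f k t j : (2 * f < j)%N -> (j.+1 < k <= n)%N ->
  turns (slide f k t j.+1) j.
Proof.
move=> fj /andP[jk kn]; rewrite /turns !shape_slide; try lia.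
rewrite leqnSn ltnn jk !base_hi /=; try lia.
by apply/eqP; congr pair; lia.
Qed.

Lemma dn_slide f k t j : slide f k t j.+1 \in tab ->
  (2 * f < j)%N -> (j.+1 < k <= n)%N ->
  dn (slide f k t j.+1) j = slide f k t j.
Proof.
move=> sT fj jk; have tk := turns_slide t fj jk.
have hj : shape (slide f k t j.+1) j = (f, j - 2 * f)%N.
  by rewrite shape_slide ?leqnSn ?base_hi //; lia.
apply: eq_graft => [|m mn]; first by apply: (dn_tab sT tk); rewrite hj /=; lia.
rewrite shape_set hj; case: eqP => [->|mj].
  by rewrite ltnn ltnW ?base_hi /=; try lia; congr pair; lia.
rewrite shape_slide // (leq_eqVlt m j.+1) (introF eqP mj) /= ltnS.
by [].
Qed.

Lemma slide_of_dn f k t u j : u \in tab -> turns u j ->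
    (2 * f < j)%N -> (j.+1 < k <= n)%N -> ((shape u j.+1).1 <= f)%N ->
  dn u j = slide f k t j -> u = slide f k t j.+1.
Proof.
move=> uT uj fj jk uf e.
have off_e m : (m <= n)%N -> m != j.+1 -> shape u m = shape (slide f k t j) m.
  by move=> mn mj; rewrite -e off_set.
have hj : shape u j = (f, j - 2 * f)%N.
  by rewrite off_e ?shape_slide ?leqnn ?base_hi //; try lia; apply/eqP; lia.
apply: (eq_graft uT) => m mn; have [->|mj] := eqVneq m j.+1; last first.
  rewrite off_e // shape_slide // (leq_eqVlt m j.+1) (negPf mj) /= ltnS.
  by [].
rewrite leqnn base_hi; last lia.
have [uu|[_ ud]] := up_or_dn uT uj.
  by rewrite uu shape_set eqxx hj /=; congr pair; lia.
by move: uf; rewrite ud shape_set eqxx hj ltnn.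
Qed.

(** Each e_(j+1) delays the down step by one vertex with factor p_(j-2f) / p_(j-2f+1), and these
    factors telescope. The bound on u discards paths that have already made this step. *)
Lemma w_start f k t j u : (2 * f < j)%N -> (j < k <= n)%N -> u \in tab ->
    ((shape u j).1 <= f)%N ->
  pact l (\prod_((2 * f).+2 <= i < j.+1) tl_e xF n i)
    (delta (slide f k t (2 * f).+1)) u =
  (pF (j - 2 * f))^-1 * (u == slide f k t j)%:R.
Proof.
move=> fj; elim: j fj u => // j IHj fj u jk uT uf.
have [->|jf] := eqVneq j (2 * f)%N.
  by rewrite big_geq // pact1 subSnn invr1 mul1r.
have {}fj : (2 * f < j)%N by lia.
rewrite big_nat_recr /=; last lia.
rewrite pactM pact_e; last lia.
have hs : u = slide f k t j.+1 -> shape u j = (f, j - 2 * f)%N.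
  by move=> ->; rewrite shape_slide ?leqnSn ?base_hi //; lia.
case uj : (turns u j); last first.
  rewrite path_e0 ?uj //; case: eqP => [us|_]; last by rewrite mulr0.
  by move: uj; rewrite us turns_slide.
have le_uj : ((shape u j).1 <= f)%N.
  by apply: leq_trans (@arcs_mono _ _ _ j j.+1 uT _) uf; lia.
have shj y : shape (set_shape u j.+1 y) j = shape u j.
  by rewrite off_set //; apply/eqP; lia.
have jk' : (j < k <= n)%N by lia.
rewrite path_eE // IHj ?up_tab ?shj //.
have -> : up u j == slide f k t j = false.
  apply/negP => /eqP/(congr1 (shape^~ j.+1)); rewrite shape_set eqxx shape_slide; last lia.
  have -> : (j.+1 <= k)%N by lia.
  rewrite ltnn base_hi; last lia.
  by case=> e _; move: le_uj; rewrite e ltnn.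
rewrite !mulr0 add0r.
have [h0|h0] := posnP (shape u j).2.
  rewrite h0 mul0r mul0r; case: eqP => [us|_]; last by rewrite mulr0.
  by move: h0; rewrite hs //=; lia.
rewrite IHj ?dn_tab ?shj //.
have -> : (dn u j == slide f k t j) = (u == slide f k t j.+1).
  apply/eqP/eqP => [|us]; first exact: slide_of_dn.
  by rewrite us dn_slide // -us.
case: eqP => [us|_]; last by rewrite !mulr0 mul0r.
rewrite hs //= subSn; last exact: ltnW.
by rewrite !mulr1 mulfV ?mul1r // -(prednK (n := (j - 2 * f)%N)) ?pF_neq0; lia.
Qed.

Definition down_weight t k : Fx := \prod_(0 <= j < k)
  if (shape t j).1 == (shape t j.+1).1 then 1 else (pF (shape t j.+1).2.+1)^-1.

(** Interpolates between t at k = 0 and the base path at k = n. *)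
Definition prefix_start t k := graft n (fun m =>
  if (m <= k)%N then base (shape t k).1 m else shape t m).

Lemma pactZr (a : TL xF n) c phi : pact l a (c *: phi) = c *: pact l a phi.
Proof.
have a0 : pact l a 0 = 0.
  by have := pact_linear l a (-1) 0 0; rewrite !scaleN1r oppr0 addr0 addNr.
by have := pact_linear l a c phi 0; rewrite addr0 a0 addr0.
Qed.

Lemma pact_v t k : t \in tab -> (k <= n)%N ->
  pact l (v_upto xF n t k) (delta (prefix_start t k)) t = down_weight t k.
Proof.
move=> tT; have /tableauP[_ t0 _ ta] := tT.
elim: k => [|k IHk] kn.
  rewrite pact1 /down_weight big_geq // /delta.
  have <- : t = prefix_start t 0; last by rewrite eqxx.
  by apply: (eq_graft tT) => -[|m] _ //=; rewrite t0.
have := IHk (ltnW kn) => {}IHk.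
rewrite v_uptoS /down_weight big_nat_recr //= -/(down_weight t k).
have pk := tableau_part tT (ltnW kn); rewrite /is_part in pk.
case/arrowP: (ta _ kn) => [e|[e h0]]; rewrite e /=.
  rewrite eqxx mulr1 -IHk; congr (pact l _ (delta _) t).
  apply: eq_mkseq => m; rewrite e /=.
  have [mk|km] := leqP m k; first by rewrite (leq_trans mk).
  rewrite leq_eqVlt ltnS leqNgt km orbF.
  by case: eqP => [->|//]; rewrite base_hi ?e; [congr pair|]; lia.
rewrite ltn_eqF // prednK //; set f := (shape t k).1 in e pk *.
have fk : (2 * f < k)%N by lia.
rewrite pactM mulrC -IHk.
have gE : prefix_start t k.+1 = slide f k.+1 t (2 * f).+1.
  apply: eq_mkseq => m; rewrite e /= -/f.
  have [mf|//] := leqP m (2 * f).+1.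
  by rewrite base_lo //; have -> : (m <= k.+1)%N by lia.
have gE' : prefix_start t k = slide f k.+1 t k.
  apply: eq_mkseq => m; rewrite -/f; case: leqP => // km.
  rewrite leq_eqVlt ltnS leqNgt km orbF.
  by case: eqP => [->|//]; rewrite base_hi ?e; [congr pair|]; lia.
(* In w v_k the word w acts first. On paths with the tail of t from k on, its result is [psi]; other
   paths are invisible to v_k, which lies in A_k. *)
pose psi : V := (pF (shape t k).2)^-1 *: delta (prefix_start t k).
have -> : (pF (shape t k).2)^-1 *
    pact l (v_upto xF n t k) (delta (prefix_start t k)) t =
    pact l (v_upto xF n t k) psi t by rewrite pactZr.
apply: (@pact_local _ _ k) => //; first exact: ltnW.
  by apply: (v_upto_subalg _ _ tT); apply: ltnW.
move=> s sT st; rewrite w_eltE; last by lia.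
rewrite /psi gE gE' mulnS w_start //; last by rewrite st.
  by rewrite -[RHS]/(_ * _) /delta; congr ((pF _)^-1 * _); lia.
by rewrite leqnn.
Qed.

Lemma down_weight_rcons s k m : size s = k.+1 ->
  down_weight (rcons s m) k.+1 =
  down_weight s k * (if (shape s k).1 == m.1 then 1 else (pF m.2.+1)^-1).
Proof.
move=> sk; rewrite /down_weight big_nat_recr //= (shape_rcons_last _ sk).
rewrite shape_rcons ?sk //; congr (_ * _).
by apply: eq_big_nat => j jk; rewrite !shape_rcons ?sk //; lia.
Qed.

Lemma path_weight_rcons s k m : size s = k.+1 ->
  path_weight k.+1 (rcons s m) = path_weight k s * pF m.2.+1.
Proof.
move=> sk; rewrite /path_weight big_nat_recr //= (shape_rcons_last _ sk); congr (_ * _).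
by apply: eq_big_nat => j jk; rewrite shape_rcons // sk.
Qed.

Lemma pact_v_start t : t \in tab ->
  pact l (v_elt xF n t) (delta (start n l)) t = down_weight t n.
Proof.
move=> tT; rewrite -(pact_v tT (leqnn n)); congr (pact l _ (delta _) t).
have /tableauP[_ _ tn _] := tT.
apply/eq_in_map => m; rewrite mem_iota tn => /andP[_ mn].
by rewrite -ltnS mn.
Qed.

End LeadingCoefficient.

(** * The cellular form *)

Lemma is_part_le n (m : nat * nat) : is_part n m -> (2 * m.1 <= n)%N.
Proof. by move=> /eqP <-; apply: leq_addr. Qed.

Lemma sdominates_lt n (m l : nat * nat) : is_part n m -> is_part n l ->
  sdominates m l -> (l.1 < m.1)%N.
Proof.
case: m l => [a b] [a' b']; rewrite /sdominates /dominates /is_part /=.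
move=> /eqP nm /eqP nl /andP[lm]; rewrite ltn_neqAle lm andbT; apply: contraNneq => aa.
by rewrite aa; apply/eqP; congr pair; lia.
Qed.

Section GramNorm.
Local Open Scope quotient_scope.
Variables (n : nat) (l : nat * nat).
Hypothesis nl : is_part n l.
Local Notation tab := (tableaux n l).
Local Notation V := (seq (nat * nat) -> Fx^o).
Local Notation A := (TL xF n).
Local Notation Q := (cell_quot xF n l).
Local Notation C := (cell xF n l).
Local Notation I := (@ideal_aboveb _ xF n l).
Local Notation start := (start n l).
Implicit Types (t s u : seq (nat * nat)) (phi psi : V).

Lemma m_part_arcs (m : nat * nat) : m_part xF n m = arcs xF n m.1.
Proof. by []. Qed.

Lemma start_in : start \in tab. Proof. exact: start_tab. Qed.

Lemma part_le : (2 * l.1 <= n)%N.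
Proof. exact: is_part_le. Qed.

(** For mu above l, m_mu is supported on paths with mu.1 down steps, more than any path of shape l
    makes. *)
Lemma ideal_kills (y : A) phi u : y \in I -> u \in tab -> pact l y phi u = 0.
Proof.
move=> /asboolP[b [Ib ->]] uT; rewrite pact_sum.
have sum0 (r : seq (nat * nat)) (P : pred (nat * nat)) (g : nat * nat -> V) :
    (forall m, m \in r -> P m -> g m u = 0) -> (\sum_(m <- r | P m) g m) u = 0.
  move=> g0; rewrite big_seq_cond.
  by elim/big_rec: _ => // m psi /andP[mr Pm] IH; rewrite fctE g0 // add0r.
apply: sum0 => m; rewrite mem_parts => nm lm.
have := Ib m nm lm; rewrite /ideal_part => Im.
elim: Im phi u uT => [_ -> | |a c _ IHa _ IHc|a c _ IHc|a c _ IHa] phi u uT.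
- have mn := is_part_le nm.
  rewrite m_part_arcs pact_arcs //.
  case r: (returns u m.1); last by rewrite !mul0r.
  have := @arcs_mono _ _ _ (2 * m.1) n uT; rewrite mn leqnn => /(_ isT).
  rewrite (returns_shape uT mn r (leqnn _)); have /tableauP[_ _ -> _] := uT.
  by rewrite leqNgt (sdominates_lt nm nl lm).
- by rewrite pact0.
- by rewrite pactD fctE IHa // IHc // addr0.
- by rewrite pactM IHc.
rewrite pactM (@pact_eq_on_tab _ _ _ _ 0) // => [|s sT]; last exact: IHa.
by have := pactZr l c 0 (0 : V); rewrite !scale0r => ->.
Qed.

Lemma pact_arcs_start : {in tab, pact l (arcs xF n l.1) (delta start) =1
  xF ^+ l.1 *: delta start}.
Proof.
move=> u uT; rewrite pact_arcs ?part_le // (returns_start nl uT) fctE /delta.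
rewrite -[RHS]/(_ * _).
by case: eqP; rewrite ?mulr0 // mul1r.
Qed.

Lemma pact_arcs_mul (a : A) : {in tab, pact l (arcs xF n l.1 * a) (delta start) =1
  xF ^+ l.1 *: pact l a (delta start)}.
Proof.
move=> u uT; rewrite pactM -pactZr; apply: pact_eq_on_tab => //.
exact: pact_arcs_start.
Qed.

(** m_lambda scales the base path by x^f, which the division undoes. By [ideal_kills] the choice of
    representative does not affect the values on tableaux. *)
Definition coords (c : C) : V :=
  xF ^- l.1 *: pact l (repr (val c)) (delta start).

Lemma coords_pi (c : C) (a : A) : val c = \pi_Q a ->
  {in tab, coords c =1 xF ^- l.1 *: pact l a (delta start)}.
Proof.
move=> ca u uT; rewrite /coords ca !fctE; congr (_ *: _).
have := ideal_kills (delta start) (@repr_cell _ _ _ l a) uT.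
rewrite pactD pactN !fctE => /eqP; rewrite subr_eq0 => /eqP.
exact.
Qed.

Lemma coords_mul (c : C) (a : A) : val c = \pi_Q (m_part xF n l * a) ->
  {in tab, coords c =1 pact l a (delta start)}.
Proof.
move=> ca u uT; rewrite (coords_pi ca) // m_part_arcs fctE pact_arcs_mul //.
by rewrite fctE scalerA mulVf ?scale1r // expf_neq0 ?xF_neq0.
Qed.

Lemma coords_linear k (c c' : C) u : u \in tab ->
  coords (k *: c + c') u = k * coords c u + coords c' u.
Proof.
move=> uT; rewrite (@coords_pi _ (k *: repr (val c) + repr (val c'))) //.
  rewrite pactD pactZ /coords !fctE scalerDr.
  by rewrite -![_ *: _]/(_ * _); ring.
rewrite linearP /= pi_cellD -cq_scaleE !reprK.
by [].
Qed.

Lemma path_form_eq phi phi' psi psi' : {in tab, phi =1 phi'} -> {in tab, psi =1 psi'} ->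
  path_form n l phi psi = path_form n l phi' psi'.
Proof.
by move=> e e'; apply: eq_big_seq => t tT; rewrite e ?e'.
Qed.

Lemma path_form_delta phi s : s \in tab ->
  path_form n l phi (delta s) = path_weight n s * phi s.
Proof.
move=> sT; rewrite /path_form (bigD1_seq s) ?tableaux_uniq //= /delta eqxx mulr1.
by rewrite big1 ?addr0 // => t /negPf->; rewrite mulr0.
Qed.

(** The division normalises the base path to norm 1. Acting on it, m_lambda v_s v_t^* m_lambda
    produces x^f twice; one is matched by m_lambda on the other side of the relation, the other
    stays here. *)
Definition gram_const : Fx := xF ^+ l.1 / path_weight n start.

Definition gram (c c' : C) : Fx :=
  gram_const * path_form n l (coords c) (coords c').

Lemma gram_bilinear : bilinear_for *%R *%R gram.
Proof.
have [Bl Br] := path_form_bilinear n l.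
split=> [c' k c1 c2|c k c1 c2] /=; rewrite /gram.
  rewrite (@path_form_eq _ (k *: coords c1 + coords c2) _ (coords c')) //; last first.
    by move=> u uT; rewrite coords_linear // !fctE.
  by have /= -> := Bl (coords c') k (coords c1) (coords c2); ring.
rewrite (@path_form_eq _ (coords c) _ (k *: coords c1 + coords c2)) //; last first.
  by move=> u uT; rewrite coords_linear // !fctE.
by have /= -> := Br (coords c) k (coords c1) (coords c2); ring.
Qed.

Lemma ideal_word_above y : lspan (ideal_word n l.1.+1) y -> y \in I.
Proof.
have [I0 ID IMl IMr] := ideal_aboveb_closed xF n l.
elim=> [//|k a b [ln [a' [b' [_ _ ->]]]] _ Ib]; apply: ID => //.
rewrite -mulr_algl; apply: IMl; apply/asboolP.
pose m := (l.1.+1, n - 2 * l.1.+1)%N.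
exists (fun mu => if mu == m then a' * arcs xF n l.1.+1 * b' else 0); split.
  move=> mu _ _; case: eqP => [->|_]; last exact: ideal_gen0.
  by apply/ideal_genMr/ideal_genMl; apply: ideal_gen_in.
have mP : m \in parts n by rewrite mem_parts /is_part /m /=; lia.
have sm : sdominates m l.
  rewrite /sdominates /dominates /m /= leqnSn /=.
  by apply/eqP => /(congr1 fst) /=; lia.
rewrite -big_filter (bigD1_seq m) ?filter_uniq ?parts_uniq ?mem_filter ?sm //=.
by rewrite eqxx big1 ?addr0 // => mu /negPf->.
Qed.

Lemma gram_m_tab s t : s \in tab -> t \in tab ->
  gram (m_tab xF n l s) (m_tab xF n l t) =
  xF ^+ l.1 * pact l (v_elt xF n s * tl_star (v_elt xF n t)) (delta start) start.
Proof.
move=> sT tT; rewrite /gram.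
have cE := coords_mul (val_m_tab xF n l _).
rewrite (path_form_eq (cE _) (cE _)).
rewrite -[v_elt xF n t]tl_starK -path_form_star -pactM path_form_delta ?start_in //.
rewrite tl_starK /gram_const mulrA mulfVK //.
by rewrite /path_weight prodf_seq_neq0; apply/allP => k _ /=; apply: pF_neq0.
Qed.

Lemma gram_cell_form : is_cell_form gram.
Proof.
split=> [|s t sT tT]; first exact: gram_bilinear.
apply/pi_cellP; set a := v_elt xF n s * tl_star (v_elt xF n t).
(* This gives some scalar; it is identified by acting on the base path and reading off the
   coefficient of that path. *)
have [|c Ic] := @arcs_cellular _ xF n l.1 n a (leqnn n) part_le.
  by apply: subalgW (subalg_full a) => i; rewrite /itv.
have {}Ic := ideal_word_above Ic.
rewrite gram_m_tab // -/a m_part_arcs -[_ * _ * tl_star _]mulrA -/a.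
suff <- : c = xF ^+ l.1 * pact l a (delta start) start by [].
have := ideal_kills (delta start) Ic start_in.
rewrite pactD pactN pactZ pactM !fctE pact_arcs ?start_in ?part_le //.
rewrite (returns_start nl start_in) eqxx mul1r pact_arcs_mul ?start_in //.
rewrite pact_arcs_start ?start_in // !fctE /delta eqxx -![_ *: _]/(_ * _) mulr1.
move/eqP; rewrite subr_eq0 => /eqP E.
have x0 : xF ^+ l.1 != 0 by rewrite expf_neq0 ?xF_neq0.
by apply: (mulIf x0); rewrite -E mulrC.
Qed.

Lemma arcs_not_above : m_part xF n l \notin I.
Proof.
apply/negP => /(ideal_kills (delta start))/(_ start_in)/eqP.
rewrite m_part_arcs pact_arcs_start ?start_in // fctE /delta eqxx -[_ *: _]/(_ * _).
by rewrite mulr1 expf_eq0 (negPf xF_neq0) andbF.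
Qed.

Lemma pi_cell0 : \pi_Q 0 = 0.
Proof. by apply: (addIr (\pi_Q 0)); rewrite -pi_cellD !add0r. Qed.

Lemma m_tab_span (P : C -> Prop) : P 0 ->
    (forall k c c', P c -> P c' -> P (k *: c + c')) ->
    {in tab, forall t, P (m_tab xF n l t)} ->
  forall c, P c.
Proof.
move=> P0 PD Pt c.
have [a ca] : exists a, val c = \pi_Q (m_part xF n l * a).
  case: c => q /= /asboolP[a ->]; exists a; exact: cq_actE.
have : lspan (standard_or_above n l.1) (arcs xF n l.1 * a).
  apply: (spanning xF_neq0) => //; first exact: part_le.
  by apply: subalgW (subalg_full a) => i; rewrite /itv.
rewrite -m_part_arcs; move: (_ * a) ca => y ca Sy.
suff [c' yc' Pc'] : exists2 c' : C, val c' = \pi_Q y & P c'.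
  by have -> : c = c' by apply: val_inj; rewrite ca.
elim: Sy => [|k u v Su _ [c' vc' Pc']].
  by exists 0 => //; rewrite raddf0 pi_cell0.
have [b ub Pb] : exists2 b : C, val b = \pi_Q u & P b.
  case: Su => [[t tT ->]|Iu].
    exists (m_tab xF n l t); first exact: val_m_tab.
    apply: Pt; move: tT; congr (t \in tableaux n _).
    by move: nl; rewrite /is_part; case: (l) => i h /= /eqP <-; rewrite addKn.
  exists 0 => //; rewrite raddf0 -pi_cell0; apply/pi_cellP; rewrite sub0r rpredN.
  exact/ideal_word_above/lspan_in.
exists (k *: b + c'); last exact: PD.
by rewrite linearP /= ub vc' pi_cellD -cq_scaleE.
Qed.

Lemma cell_formE (c c' : C) : cell_form c c' = gram c c'.
Proof.
have [bl mm] : is_cell_form (@cell_form _ xF n l).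
  by apply: xgetPex; exists gram; apply: gram_cell_form.
have [gl gm] := gram_cell_form.
have lin0 (B : C -> C -> Fx) : bilinear_for *%R *%R B ->
    (forall x, B 0 x = 0) * (forall x, B x 0 = 0).
  move=> [Bl Br]; split=> x.
    by have /= := Bl x (-1) 0 0; rewrite !scaleN1r oppr0 addr0 mulN1r addNr.
  by have /= := Br x (-1) 0 0; rewrite !scaleN1r oppr0 addr0 mulN1r addNr.
have [b0 b0'] := lin0 _ bl; have [g0 g0'] := lin0 _ gl.
have [bll blr] := bl; have [gll glr] := gl.
move: c; apply: m_tab_span => [|k c1 c2 e1 e2|s sT]; first by rewrite b0 g0.
  by have /= -> := bll c' k c1 c2; have /= -> := gll c' k c1 c2; rewrite e1 e2.
move: c'; apply: m_tab_span => [|k c1 c2 e1 e2|t tT]; first by rewrite b0' g0'.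
  set m := m_tab _ _ _ _ in e1 e2 *.
  by have /= -> := blr m k c1 c2; have /= -> := glr m k c1 c2; rewrite e1 e2.
(* The difference of the two values multiplies m_lambda into the higher ideal; were it nonzero,
   m_lambda itself would lie there. *)
have := gm s t sT tT; rewrite mm // => /pi_cellP; rewrite -scalerBl => Im.
apply/eqP; rewrite -subr_eq0; move: (_ - _) Im => k Im.
apply: contraNT arcs_not_above => k0.
have [_ _ IM _] := ideal_aboveb_closed xF n l.
by have := IM (k^-1)%:A _ Im; rewrite mulr_algl scalerA mulVf ?scale1r.
Qed.

Lemma f_tab_norm t : t \in tab ->
  cell_form (f_tab n l t) (f_tab n l t) =
  gram_const * (path_weight n t * down_weight t n ^+ 2).
Proof.
move=> tT; rewrite cell_formE /gram; congr (_ * _).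
have vf : val (f_tab n l t) = \pi_Q (m_part xF n l * (v_elt xF n t * F_elt n t)).
  by rewrite -[LHS]/(cq_act _ _) val_m_tab cq_actE mulrA.
have fE : {in tab, coords (f_tab n l t) =1 down_weight t n *: delta t}.
  move=> u uT; rewrite (coords_mul vf) // pactM F_proj // fctE /delta.
  case: eqP => [->|_]; last by rewrite mul0r; apply/esym/mulr0.
  by rewrite mul1r pact_v_start //; apply/esym/mulr1.
rewrite (path_form_eq fE fE).
have [_ Br] := path_form_bilinear n l.
have /= := Br (down_weight t n *: delta t) (down_weight t n) (delta t) 0.
have /= := Br (down_weight t n *: delta t) (-1) 0 0.
rewrite !scaleN1r oppr0 !addr0 mulN1r addNr => ->; rewrite addr0 => ->.
rewrite path_form_delta // fctE /delta eqxx -[_ *: _]/(_ * _).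
by rewrite mulr1; ring.
Qed.

End GramNorm.

(** * The recursion *)

Definition pF_fact h : Fx := \prod_(0 <= j < h) pF j.+1.

Lemma pF_factS h : pF_fact h.+1 = pF_fact h * pF h.+1.
Proof. by rewrite /pF_fact big_nat_recr. Qed.

Lemma pF_fact_neq0 h : pF_fact h != 0.
Proof. by rewrite /pF_fact prodf_seq_neq0; apply/allP => k _ /=; apply: pF_neq0. Qed.

(** Each zigzag contributes p_1 p_2 = x, and the final ascent p_1 ... p_(h+1). *)
Lemma path_weight_start n f h : n = (2 * f + h)%N ->
  path_weight n (start n (f, h)) = xF ^+ f * pF_fact h.+1.
Proof.
move=> nE; rewrite /path_weight.
transitivity (\prod_(0 <= k < n.+1) pF (base f k).2.+1).
  by apply: eq_big_nat => k kn; rewrite shape_graft.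
rewrite {n}nE; elim: h => [|h IHh].
  rewrite addn0 /pF_fact big_nat1 mulr1; elim: f => [|f IHf].
    by rewrite muln0 big_nat1.
  have -> : (2 * f.+1 = (2 * f).+2)%N by lia.
  rewrite big_nat_recr //= big_nat_recr //= exprSr -IHf.
  have -> : base f.+1 (2 * f).+1 = (f, 1%N) by rewrite base_lo // base_hi // subSnn.
  have -> : base f.+1 (2 * f).+2 = (f.+1, 0%N) by rewrite base_hi; [congr pair|]; lia.
  rewrite mulr1 pFS mulr1 subr0; congr (_ * _).
  by apply: eq_big_nat => k kf; rewrite base_lo //; lia.
rewrite addnS big_nat_recr //= IHh base_hi; last by lia.
by rewrite (pF_factS h.+1) mulrA; congr (_ * pF _) => /=; lia.
Qed.

Lemma gram_constE n f h : n = (2 * f + h)%N ->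
  gram_const n (f, h) = (pF_fact h.+1)^-1.
Proof.
move=> nE; rewrite /gram_const (path_weight_start nE) invfM mulrA mulfV ?mul1r //.
by rewrite expf_neq0 ?xF_neq0.
Qed.

Definition gram_norm n h t : Fx := path_weight n t * down_weight t n ^+ 2 / pF_fact h.+1.

Lemma det_partE n l : is_part n l ->
  det_part n l = \prod_(t <- tableaux n l) gram_norm n l.2 t.
Proof.
move=> nl; apply: eq_big_seq => t tT; rewrite f_tab_norm //.
case: l nl tT => f h /eqP nE _; rewrite gram_constE; last exact/esym.
by rewrite mulrC.
Qed.

Lemma gram_norm_up n f h s : s \in tableaux n (f, h) ->
  gram_norm n.+1 h.+1 (rcons s (f, h.+1)) = gram_norm n h s.
Proof.
move=> /tableauP[ss _ sn _]; rewrite /gram_norm path_weight_rcons // down_weight_rcons //.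
rewrite sn eqxx mulr1 (pF_factS h.+1) /=.
have cancel (K : fieldType) (p q g w : K) : p != 0 -> q != 0 ->
    g * p * w ^+ 2 / (q * p) = g * w ^+ 2 / q.
  by move=> p0 q0; field; apply/andP.
by rewrite cancel ?pF_neq0 ?pF_fact_neq0.
Qed.

(** The new vertex contributes p_(h+1) to the weight and p_(h+1)^(-2) as a descent, and the
    denominator loses p_(h+2). *)
Lemma gram_norm_down n f h s : s \in tableaux n (f, h.+1) ->
  gram_norm n.+1 h (rcons s (f.+1, h)) = gram_norm n h.+1 s * (pF h.+2 / pF h.+1).
Proof.
move=> /tableauP[ss _ sn _]; rewrite /gram_norm path_weight_rcons // down_weight_rcons //.
rewrite sn /= ltn_eqF // (pF_factS h.+1).
have cancel (K : fieldType) (p p' q g w : K) : p != 0 -> p' != 0 -> q != 0 ->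
    g * p * (w / p) ^+ 2 / q = g * w ^+ 2 / (q * p') * (p' / p).
  by move=> p0 p0' q0; field; apply/and3P.
by apply: cancel; rewrite ?pF_neq0 ?pF_fact_neq0.
Qed.

Theorem lemma5p1 (n f : nat) (hf : (1 <= f)%N) (hn : (2 * f <= n)%N) :
  let lam := (f, (n - 2 * f)%N) in
  let mu := ((f - 1)%N, (n - 2 * f + 1)%N) in
  det_part n lam =
    (\prod_(nu <- parts (n - 1) | arrow nu lam) det_part (n - 1) nu)
    * (pF (n - 2 * f + 2) / pF (n - 2 * f + 1)) ^+ dim_part (n - 1) mu.
Proof.
move=> lam mu; rewrite {}/lam {}/mu.
case: f hf hn => // f _ hn; case: n hn => // n hn.
rewrite !subn1 /= addn1 addn2.
move: (n.+1 - 2 * f.+1)%N (subnK hn) => h nE.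
have ln : is_part n.+1 (f.+1, h) by rewrite /is_part /= -nE addnC.
rewrite det_partE // tableauxS ln big_allpairs_dep big_filter; set r := pF h.+2 / pF h.+1.
(* Only tableaux through (f, h+1), with f now lowered by one, end in a down step. Each contributes
   one factor r, so the exponent is their number. *)
transitivity (\prod_(nu <- parts n | arrow nu (f.+1, h))
   (det_part n nu * (if nu == (f, h.+1) then r ^+ dim_part n nu else 1))).
  rewrite big_seq_cond [RHS]big_seq_cond; apply: eq_bigr => nu /andP[].
  rewrite mem_parts => nun ar; rewrite det_partE //.
  case: nu nun ar => g k nun /orP[] /= /andP[/eqP ge /eqP ke].
    have -> : (g, k) == (f, h.+1) = false by apply/eqP => -[]; lia.
    rewrite mulr1; apply: eq_big_seq => t; rewrite ge -ke.
    exact: gram_norm_up.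
  case: ge => ge; rewrite {}ge {}ke eqxx /dim_part in nun *.
  transitivity (\prod_(t <- tableaux n (f, h.+1)) (gram_norm n h.+1 t * r)).
    by apply: eq_big_seq => t /gram_norm_down.
  by rewrite big_split /= big_const_seq count_predT iter_mulr_1.
rewrite big_split /=; congr (_ * _).
have mu_parts : (f, h.+1) \in parts n by rewrite mem_parts /is_part /=; lia.
rewrite -big_filter (bigD1_seq (f, h.+1)) ?filter_uniq ?parts_uniq //; last first.
  by rewrite mem_filter mu_parts andbT; apply/arrowP; right.
by rewrite /= eqxx big1 ?mulr1 // => nu /negPf->.
Qed.
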